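(* Let $\iota\colon L\times[0,1]\to J^1\mathbb{R}^n$ be a Legendrian isotopy in $J^1\mathbb{R}^n$, $n\ge1$, that is induced by a path of contactomorphisms and that is positive outside a compact subset (i.e. there is a compact $C\subset L$ with $\alpha(d\iota(\partial_t))>0$ on $(L\setminus C)\times[0,1]$). Write $L_t=\iota(L\times\{t\})$. Then there exists a positive smooth isotopy $\hat\iota\colon L\times[0,1]\to J^1\mathbb{R}^n$ between $L_0$ and $L_1$ that coincides with $\iota$ in the complement of a compact subset (i.e. on $(L\setminus C')\times[0,1]$ for some compact $C'\subset L$).
   Context: $J^1\mathbb{R}^n=T^*\mathbb{R}^n\times\mathbb{R}$ carries its canonical cooriented contact structure $\xi=\ker\alpha$, and is contactomorphic to $\mathbb{R}^{2n+1}$ with the standard contact structure $\ker\left(dz+\sum_{i=1}^n x_i\,dy_i\right)$. A Legendrian is an $n$-dimensional submanifold tangent to $\xi$. An isotopy is a smooth family of embeddings $\iota\colon L\times[0,1]\to J^1\mathbb{R}^n$ (a smooth map such that each $\iota(\cdot,t)$ is an embedding); it is an isotopy between $\iota(L\times\{0\})$ and $\iota(L\times\{1\})$. All embeddings are assumed proper, in the sense that the intersection of the image with any compact set is compact. It is a Legendrian isotopy if each $\iota(L\times\{t\})$ is Legendrian. It is positive if $\alpha(d\iota(\partial_t))>0$ at every point of $L\times[0,1]$. It is induced by a path of contactomorphisms if there is a smooth path $(f_t)_{t\in[0,1]}$ of contactomorphisms of $J^1\mathbb{R}^n$ (diffeomorphisms preserving $\xi$, with $(t,p)\mapsto f_t(p)$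 smooth) with $f_0=\mathrm{id}$ and $\iota(p,t)=f_t(\iota(p,0))$ for all $p\in L$, $t\in[0,1]$. *)

(* Defs.v *)
From HB Require Import structures.
From mathcomp Require Import all_boot all_order all_algebra.
From mathcomp Require Import all_classical all_reals all_analysis.

Set Implicit Arguments.
Unset Strict Implicit.
Unset Printing Implicit Defensive.

Import Order.TTheory GRing.Theory Num.Theory.
Import numFieldNormedType.Exports.

Local Open Scope classical_set_scope.
Local Open Scope ring_scope.

(** * Smooth maps between normed spaces *)

(* iter_derive f [:: v1; ...; vk] = D_v1 (... (D_vk f)) *)
Definition iter_derive (R : realType) (V W : normedModType R)
    (f : V -> W) (s : seq V) : V -> W :=
  foldr (fun v g => 'D_v g) f s.

(* C^oo on an open set U *)
Definition smooth_open (R : realType) (V W : normedModType R)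
    (U : set V) (f : V -> W) : Prop :=
  forall (s : seq V) (x : V), U x -> differentiable (iter_derive f s) x.

(* On an arbitrary set A (open sets times [0, 1] below), smooth means locally
   the restriction of a smooth map defined on an open set; the values of f
   outside of A are irrelevant. *)
Definition smooth_on (R : realType) (V W : normedModType R)
    (A : set V) (f : V -> W) : Prop :=
  forall a, A a -> exists (U : set V) (g : V -> W),
    [/\ open U, U a, smooth_open U g & forall x, U x -> A x -> g x = f x].

Definition I01 (R : realType) : set R := `[0, 1].
Arguments I01 {R}.

(** * Smooth manifolds (without boundary) *)

(* cmap and cinv are total functions, meaningful on cdom and cmap @` cdom. *)
Record chart (R : realType) (n : nat) (L : topologicalType) := Chart {
  cdom : set L ;
  cmap : L -> 'rV[R]_n ;
  cinv : 'rV[R]_n -> L ;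
  cdom_open : open cdom ;
  cimg_open : open (cmap @` cdom) ;
  cmapK : forall p, cdom p -> cinv (cmap p) = p ;
  cmap_continuous : {within cdom, continuous cmap} ;
  cinv_continuous : {within cmap @` cdom, continuous cinv} }.

Definition cimg (R : realType) (n : nat) (L : topologicalType)
  (c : chart R n L) : set 'rV[R]_n := cmap c @` cdom c.

(* The atlas is not required to be maximal. *)
Record smooth_manifold (R : realType) (n : nat) := SmoothManifold {
  carrier :> topologicalType ;
  carrier_hausdorff : hausdorff_space carrier ;
  carrier_second_countable : @second_countable carrier ;
  atlas : set (chart R n carrier) ;
  atlas_cover : forall p, exists2 c, atlas c & cdom c p ;
  atlas_compatible : forall c c', atlas c -> atlas c' ->
    smooth_on (cmap c @` (cdom c `&` cdom c')) (cmap c' \o cinv c) }.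

(** * The contact manifold J^1 R^n = T^*R^n x R, with points ((q, p), z) *)

Notation J1 R n := ('rV[R]_n * 'rV[R]_n * R)%type.

(* alpha = dz - \sum_i p_i dq_i, at the point x, on the tangent vector v *)
Definition contact_form (R : realType) (n : nat) (x v : J1 R n) : R :=
  v.2 - \sum_(i < n) x.1.2 0 i * v.1.1 0 i.

Definition contact_plane (R : realType) (n : nat) (x : J1 R n) : set (J1 R n) :=
  [set v | contact_form x v = 0].

(** * Proper embeddings of a manifold in J^1 R^n *)

Section Embeddings.
Context (R : realType) (n m : nat) (L : smooth_manifold R m).
Implicit Type f : L -> J1 R n.

Definition smooth_map f : Prop :=
  forall c, atlas c -> smooth_on (cimg c) (f \o cinv c).

(* df at p, read in the chart c *)
Definition chart_diff f (c : chart R m L) (p : L) : 'rV[R]_m -> J1 R n :=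
  'd (f \o cinv c) (cmap c p).

Definition immersion f : Prop :=
  forall c p, atlas c -> cdom c p -> injective (chart_diff f c p).

Definition topological_embedding f : Prop :=
  injective f /\
  forall U : set L, open U <-> exists2 O : set (J1 R n), open O & f @^-1` O = U.

Definition proper_image f : Prop :=
  forall K : set (J1 R n), compact K -> compact (range f `&` K).

Definition proper_embedding f : Prop :=
  [/\ smooth_map f, immersion f, topological_embedding f & proper_image f].

Definition tangent_to_contact f : Prop :=
  forall c p, atlas c -> cdom c p ->
    range (chart_diff f c p) `<=` contact_plane (f p).

End Embeddings.

Definition legendrian_embedding (R : realType) (n : nat)
    (L : smooth_manifold R n) (f : L -> J1 R n) : Prop :=
  proper_embedding f /\ tangent_to_contact f.

(** * Isotopies: iota p t is only meaningful for t in [0, 1] *)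

Section Isotopies.
Context (R : realType) (n m : nat) (L : smooth_manifold R m).
Implicit Type iota : L -> R -> J1 R n.

Definition smooth_family iota : Prop :=
  forall c, atlas c ->
    smooth_on (cimg c `*` I01)
      (fun u : 'rV[R]_m * R => iota (cinv c u.1) u.2).

Definition isotopy iota : Prop :=
  smooth_family iota /\
  forall t, I01 t -> proper_embedding (fun p => iota p t).

Definition slice iota (t : R) : set (J1 R n) := range (fun p => iota p t).

Definition isotopy_between iota (L0 L1 : set (J1 R n)) : Prop :=
  [/\ isotopy iota, slice iota 0 = L0 & slice iota 1 = L1].

(* d iota(partial_t) at (p, t), for t in [0, 1]: the difference quotients only
   use times in [0, 1], so that this is a one-sided derivative at 0 and 1. *)
Definition velocity iota (p : L) (t : R) : J1 R n :=
  lim ((h^-1 *: (iota p (t + h) - iota p t))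
         @[h --> within [set h | I01 (t + h)] (0^')]).

Definition positive_at iota (p : L) (t : R) : Prop :=
  0 < contact_form (iota p t) (velocity iota p t).

Definition positive_outside (C : set L) iota : Prop :=
  forall p t, ~ C p -> I01 t -> positive_at iota p t.

Definition positive_isotopy iota : Prop :=
  isotopy iota /\ forall p t, I01 t -> positive_at iota p t.

End Isotopies.

Definition legendrian_isotopy (R : realType) (n : nat) (L : smooth_manifold R n)
    (iota : L -> R -> J1 R n) : Prop :=
  isotopy iota /\
  forall t, I01 t -> legendrian_embedding (fun p => iota p t).

(** * Paths of contactomorphisms *)

Section Contactomorphisms.
Context (R : realType) (n : nat).

Definition diffeomorphism (f : J1 R n -> J1 R n) : Prop :=
  smooth_open setT f /\
  exists g, [/\ smooth_open setT g, cancel f g & cancel g f].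

Definition contactomorphism (f : J1 R n -> J1 R n) : Prop :=
  diffeomorphism f /\
  forall x, 'd f x @` contact_plane x = contact_plane (f x).

Definition contactomorphism_path (f : R -> J1 R n -> J1 R n) : Prop :=
  smooth_on (I01 `*` setT) (fun u : R * J1 R n => f u.1 u.2) /\
  forall t, I01 t -> contactomorphism (f t).

Definition induced_by_contactomorphisms (L : smooth_manifold R n)
    (iota : L -> R -> J1 R n) : Prop :=
  exists f : R -> J1 R n -> J1 R n,
    [/\ contactomorphism_path f, forall x, f 0 x = x &
        forall p t, I01 t -> iota p t = f t (iota p 0)].

End Contactomorphisms.

(* Main.v *)
From HB Require Import structures.
Require Import Defs.
From mathcomp Require Import all_boot all_order all_algebra ring lra.
From mathcomp Require Import all_classical all_reals all_analysis.

(** The isotopy has the form iota p t = f t (iota p 0) for a path f of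
    contactomorphisms starting at the identity. Precompose f with a loop of maps
    Phi t of the whole space, starting and ending at the identity and equal to
    the identity off a ball, and set iota' p t = f t (Phi t (iota p 0)). The
    slices at times 0 and 1 and the isotopy outside a compact set do not change.
    As f t preserves the contact planes and their coorientation, the contact
    form evaluated on the velocity of iota' is
      H(t, y) + mu(t, y) * alpha (d/dt Phi t x),  x = iota p 0,  y = Phi t x,
    where H is the contact Hamiltonian of f and mu > 0 its conformal factor
    (contact_form_velocity, conformal_gt0). For the constant loop this says that
    H(t, x) > 0 whenever p lies outside the given compact set C.

    Nothing asks Phi t to be a contactomorphism, and this freedom makes the loop
    easy to find. In the contact space a point can run through a small closed
    curve that is positively transverse to the contact planes: let (q_1, p_1)
    turn around a small circle, in the sense for which the integral of p dq over
    a turn is negative, so that dz - p dq can stay positive while z comes back to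
    its starting value. Turning N times around a circle of radius e costs a
    displacement of order e only, while the speed alpha (d/dt Phi t x) is a
    constant k of order e^2 N that can be prescribed. Scaling the loop at x
    by a bump function rho(x) multiplies this speed by rho(x)^2, so that it
    stays nonnegative everywhere (contact_form_loop_shift), however rho behaves.

    Now take rho positive on iota_0(C). At each (t, x) with x in the closed
    ball and in the image of iota_0, either H(t, x) > 0 or rho(x) > 0. By
    compactness there are one constant k and one tolerance d such that
    H(t, y) + mu(t, y) k rho(x)^2 > 0 as soon as |x - y| <= d (uniform_margin).
    A radius e small enough and N determined by k then give positivity.

    It remains to see that p |-> f t (Phi t (iota p 0)) is a proper embedding.
    The displacement Phi t - id is smooth with compact support, hence Lipschitz,
    with constant of order e; once that constant is at most 1/2, Phi t is
    expanding up to a factor, so it is an injective immersion, a homeomorphism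
    onto its image and proper (small_perturbation_closed_embedding). These
    properties are stable under composition with diffeomorphisms and carry
    proper embeddings to proper embeddings.

    Smoothness is differentiability of all iterated directional derivatives, so
    a calculus is built first: sums, products, pairs and composites of such
    maps, the last by expanding the differential of the outer map in a finite
    frame; then the smoothness of sin, cos and of the flat function exp(-1/x),
    from which bump functions are made. *)

Set Implicit Arguments.
Unset Strict Implicit.
Unset Printing Implicit Defensive.
Import Order.TTheory GRing.Theory Num.Theory.
Import numFieldNormedType.Exports.
Local Open Scope classical_set_scope.
Local Open Scope ring_scope.

(** * Calculus of smooth maps *)

Section DifferentialLemmas.
Context (R : realType).
Implicit Types V W : normedModType R.

Lemma is_diff_expansion V W (f : V -> W) (df : {linear V -> W}) x :
  continuous df -> f \o shift x = cst (f x) + df +o_ 0 id -> is_diff x f df.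
Proof.
move=> dfc fE; have dE := diff_unique dfc fE.
by apply: DiffDef => //; apply/diff_locallyP; rewrite dE.
Qed.

(** The differential is picked by a choice operator, so its locality has to be
    derived from the uniqueness of the first-order expansion. *)
Lemma near_eq_is_diff V W (f g : V -> W) x :
  (\near x, f x = g x) -> differentiable f x -> is_diff x g ('d f x).
Proof.
move=> fg df; apply: is_diff_expansion; first exact: diff_continuous.
have [_ /eqaddoP fE] := (diff_locallyP _ _).1 df.
apply/eqaddoP => e e0; have := fE e e0.
have fgx := nbhs_singleton fg.
have : \forall h \near 0, f (h + x) = g (h + x).
  by move: fg; rewrite (near_shift 0) subr0.
apply: filterS2 => h /= fgh.
by rewrite !fctE /= -fgh -fgx.
Qed.

Lemma scale_bilinear W : bilinear_for
    (GRing.Scale.Law.clone _ _ *:%R _) (GRing.Scale.Law.clone _ _ *:%R _)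
    ( *:%R : R -> W -> W).
Proof.
split=> [u'|u] a x y /=; first by rewrite scalerDl scalerA.
by rewrite scalerDr !scalerA mulrC.
Qed.

(** Leibniz rule for a scalar function times a vector-valued one, obtained from
    the bilinearity of scaling. *)
Lemma differentiable_scale V W (s : V -> R) (f : V -> W) x :
  differentiable s x -> differentiable f x ->
  is_diff x (fun y => s y *: f y) (fun v => s x *: 'd f x v + 'd s x v *: f x).
Proof.
move=> ds df.
pose B : {bilinear R -> W -> W} := HB.pack ( *:%R : R -> W -> W)
   (bilinear_isBilinear.Build _ _ _ _ _ _ ( *:%R : R -> W -> W) (@scale_bilinear W)).
have Bc : continuous (fun p : R * W => B p.1 p.2) by move=> p; exact: scale_continuous.
have dP := differentiable_pair ds df.
have dBP : differentiable (fun p : R * W => B p.1 p.2) ((fun y => (s y, f y)) x).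
  exact: differentiable_bilin.
apply: DiffDef; first exact: (differentiable_comp dP dBP).
have := (diff_comp dP dBP).
by rewrite diff_pair// diff_bilin.
Qed.

End DifferentialLemmas.

(** Finite order of differentiability, unfolded from the inside: the recursion
    bears on the first derivative taken, which is what induction on the order
    needs, whereas the iterated derivatives of a smooth map grow on the outside. *)
Fixpoint differentiable_upto (R : realType) (V W : normedModType R) (k : nat)
    (U : set V) (f : V -> W) : Prop :=
  (forall x, U x -> differentiable f x) /\
  if k is k'.+1 then forall v, differentiable_upto k' U ('D_v f) else True.

(** Finite dimension in the only form used below: continuous coordinates l i and
    vectors e i that reconstruct every vector. No uniqueness is asked for, so
    frames of a product are obtained by concatenation. *)
Definition finite_frame (R : realType) (V : normedModType R) :=
  exists (I : finType) (e : I -> V) (l : I -> V -> R),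
   [/\ forall i, linear (l i), forall i, continuous (l i) & forall v, v = \sum_i l i v *: e i].

Section SmoothCalculus.
Context (R : realType).
Implicit Types V W : normedModType R.

Lemma linear_pack V W (l : V -> W) : linear l -> exists L : {linear V -> W}, l = L :> (V -> W).
Proof.
move=> ll; pose L : {linear V -> W} := HB.pack l (GRing.isLinear.Build _ _ _ _ l ll).
by exists L.
Qed.

Lemma smooth_openP V W (U : set V) (f : V -> W) :
  smooth_open U f <-> forall k, differentiable_upto k U f.
Proof.
split=> [fs k|fk s].
  elim: k f fs => [|k IH] f fs; split=> //; try exact: fs [::].
  by move=> v; apply: IH => s x; have := fs (rcons s v) x; rewrite /iter_derive foldr_rcons.
have {fk} := fk (size s).
elim/last_ind: s f => [|s v IH] f; first by case.
rewrite size_rcons /iter_derive => -[_ /(_ v)] /IH.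
by rewrite foldr_rcons.
Qed.

Lemma upto_diff V W k (U : set V) (f : V -> W) :
  differentiable_upto k U f -> forall x, U x -> differentiable f x.
Proof. by case: k => [|k] []. Qed.

Lemma upto_pred V W k (U : set V) (f : V -> W) :
  differentiable_upto k.+1 U f -> differentiable_upto k U f.
Proof.
elim: k f => [|k IH] f; first by case.
by move=> [df Df]; split=> // v; apply/IH/Df.
Qed.

Lemma upto_ext V W k (U : set V) (f g : V -> W) : open U ->
  (forall x, U x -> f x = g x) ->
  differentiable_upto k U f -> differentiable_upto k U g.
Proof.
move=> oU; have nU x : U x -> \near x, U x by move=> Ux; apply: open_nbhs_nbhs.
have near x h1 h2 : U x -> (forall x, U x -> h1 x = h2 x :> W) -> \near x, h1 x = h2 x.
  by move=> /nU + h12; apply: filterS.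
elim: k f g => [|k IH] f g fg [df Df].
  by split=> // x Ux; case: (near_eq_is_diff (near _ _ _ Ux fg) (df x Ux)).
split=> [x Ux|v]; first by case: (near_eq_is_diff (near _ _ _ Ux fg) (df x Ux)).
apply: IH (Df v) => x Ux.
exact/near_eq_derive/near.
Qed.

Lemma upto_cst V W k (U : set V) (c : W) : differentiable_upto k U (cst c).
Proof.
elim: k c => [|k IH] c; split=> // v.
rewrite (_ : 'D_v (cst c) = cst 0) //.
by apply/funext => x; rewrite derive_cst.
Qed.

Lemma upto_linear V W k (U : set V) (l : V -> W) : linear l -> continuous l ->
  differentiable_upto k U l.
Proof.
move=> /linear_pack[L ->] {l}; move: L => l.
move=> lc; have dl x : U x -> differentiable l x by move=> _; exact: linear_differentiable.
case: k => [|k]; split=> // v.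
rewrite (_ : 'D_v l = cst (l v)); first exact: upto_cst.
apply/funext => x; rewrite deriveE ?diff_lin//.
exact: linear_differentiable.
Qed.

Lemma upto_add V W k (U : set V) (f g : V -> W) : open U ->
  differentiable_upto k U f -> differentiable_upto k U g ->
  differentiable_upto k U (fun x => f x + g x).
Proof.
move=> oU; elim: k f g => [|k IH] f g [df Df] [dg Dg].
  by split=> // x Ux; apply: differentiableD; [exact: df|exact: dg].
split=> [x Ux|v]; first by apply: differentiableD; [exact: df|exact: dg].
apply: upto_ext (IH _ _ (Df v) (Dg v)) => // x Ux.
by rewrite deriveD//; apply: diff_derivable; [exact: df|exact: dg].
Qed.

Lemma upto_sum V W k (U : set V) (I : Type) (r : seq I) (F : I -> V -> W) : open U ->
  (forall i, differentiable_upto k U (F i)) ->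
  differentiable_upto k U (fun x => \sum_(i <- r) F i x).
Proof.
move=> oU dF; elim: r => [|i r IH].
  apply: (@upto_ext _ _ _ _ (cst 0)) => //; last exact: upto_cst.
  by move=> x _; rewrite big_nil.
apply: upto_ext (upto_add oU (dF i) IH) => // x _.
by rewrite big_cons.
Qed.

Lemma upto_scale V W k (U : set V) (s : V -> R) (f : V -> W) : open U ->
  differentiable_upto k U s -> differentiable_upto k U f ->
  differentiable_upto k U (fun x => s x *: f x).
Proof.
move=> oU; elim: k s f => [|k IH] s f ds df.
  split=> // x Ux.
  by case: (differentiable_scale (upto_diff ds Ux) (upto_diff df Ux)).
split=> [x Ux|v].
  by case: (differentiable_scale (upto_diff ds Ux) (upto_diff df Ux)).
have [Ds Df] := (ds.2 v, df.2 v).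
have := upto_add oU (IH _ _ (upto_pred ds) Df) (IH _ _ Ds (upto_pred df)).
apply: upto_ext => // x Ux.
have [dsf sfE] := differentiable_scale (upto_diff ds Ux) (upto_diff df Ux).
rewrite [RHS]deriveE// [RHS](congr1 (fun h => h v) sfE)/= !deriveE//.
- exact: upto_diff ds _ _.
- exact: upto_diff df _ _.
Qed.

Lemma upto_pair V W1 W2 k (U : set V) (f : V -> W1) (g : V -> W2) : open U ->
  differentiable_upto k U f -> differentiable_upto k U g ->
  differentiable_upto k U (fun x => (f x, g x)).
Proof.
move=> oU; elim: k f g => [|k IH] f g [df Df] [dg Dg].
  by split=> // x Ux; apply: differentiable_pair; [exact: df|exact: dg].
split=> [x Ux|v]; first by apply: differentiable_pair; [exact: df|exact: dg].
apply: upto_ext (IH _ _ (Df v) (Dg v)) => // x Ux.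
have dfx := df x Ux; have dgx := dg x Ux.
by rewrite !deriveE ?diff_pair//; exact: differentiable_pair.
Qed.

Lemma upto_linear_comp V W1 W2 k (U : set V) (f : V -> W1) (l : W1 -> W2) :
  linear l -> continuous l -> open U ->
  differentiable_upto k U f -> differentiable_upto k U (l \o f).
Proof.
move=> /linear_pack[L ->] {l}; move: L => l.
move=> lc oU; elim: k f => [|k IH] f [df Df].
  split=> // x Ux; apply: differentiable_comp; first exact: df.
  exact: linear_differentiable.
split=> [x Ux|v].
  apply: differentiable_comp; first exact: df.
  exact: linear_differentiable.
apply: upto_ext (IH _ (Df v)) => // x Ux.
have dl : differentiable l (f x) by exact: linear_differentiable.
have dfx := df x Ux.
rewrite [RHS]deriveE; last exact: differentiable_comp.
by rewrite diff_comp// diff_lin//= deriveE.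
Qed.

(** The chain rule reads D_v (g o f) = sum_i l_i(D_v f) (D_(e_i) g o f) in a frame
    of the middle space, and the factors of the right-hand side involve one
    derivative less of f and of g, so that induction on the order applies. *)
Lemma upto_comp V1 V2 V3 k (U : set V1) (U' : set V2) (f : V1 -> V2) (g : V2 -> V3) :
  finite_frame V2 -> open U -> (forall x, U x -> U' (f x)) ->
  differentiable_upto k U f -> differentiable_upto k U' g ->
  differentiable_upto k U (g \o f).
Proof.
move=> [I [e [l [ll lc eE]]]] oU fU.
elim: k f g fU => [|k IH] f g fU df dg.
  split=> // x Ux; apply: differentiable_comp; first exact: upto_diff df _ _.
  exact/(upto_diff dg)/fU.
split=> [x Ux|v].
  apply: differentiable_comp; first exact: upto_diff df _ _.
  exact/(upto_diff dg)/fU.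
have : differentiable_upto k U
    (fun x => \sum_(i <- index_enum I) l i ('D_v f x) *: ('D_(e i) g (f x))).
  apply: upto_sum => // i; apply: upto_scale => //.
    exact/upto_linear_comp/df.2.
  by apply: IH (dg.2 _) => //; exact: upto_pred df.
apply: upto_ext => // x Ux.
have dfx := upto_diff df Ux; have dgx := upto_diff dg (fU _ Ux).
rewrite [RHS]deriveE; last exact: differentiable_comp.
rewrite diff_comp//= [in RHS](eE ('d f x v)) linear_sum.
by apply: eq_bigr => i _; rewrite linearZ/= -!deriveE.
Qed.

Lemma frame_R : finite_frame (R : normedModType R).
Proof.
exists 'I_1, (fun=> 1), (fun=> idfun); split.
- by move=> i a x y.
- by move=> i x.
by move=> v; rewrite big_ord1 /= [RHS]mulr1.
Qed.

Lemma frame_prod V W : finite_frame V -> finite_frame W ->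
  finite_frame (V * W : normedModType R)%type.
Proof.
move=> [I [e [l [ll lc eE]]]] [I' [e' [l' [ll' lc' eE']]]].
exists (I + I')%type, (fun i => match i with inl i => (e i, 0) | inr i => (0, e' i) end),
  (fun i => match i with inl i => l i \o fst | inr i => l' i \o snd end).
split=> [[i|i] a x y|[i|i] x|[v w]] /=; [exact: ll|exact: ll'| | |].
- by apply: continuous_comp; [exact: cvg_fst|exact: lc].
- by apply: continuous_comp; [exact: cvg_snd|exact: lc'].
rewrite big_sumType/=; apply: injective_projections => /=.
  rewrite [LHS]eE !raddf_sum/= [X in _ + X]big1 ?addr0// => i _.
  by rewrite scaler0.
rewrite [LHS]eE' !raddf_sum/= [X in X + _]big1 ?add0r// => i _.
by rewrite scaler0.
Qed.

Lemma frame_rV n : finite_frame ('rV[R]_n : normedModType R).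
Proof.
exists 'I_n, (delta_mx 0), (fun i (v : 'rV[R]_n) => v 0 i).
split=> [i a x y|i|v].
- by rewrite !mxE.
- exact: coord_continuous.
- exact: row_sum_delta.
Qed.

Lemma smooth_open_diff V W (U : set V) (f : V -> W) x :
  smooth_open U f -> U x -> differentiable f x.
Proof. by move=> /(_ [::]); exact. Qed.

Lemma smooth_open_ext V W (U : set V) (f g : V -> W) : open U ->
  (forall x, U x -> f x = g x) -> smooth_open U f -> smooth_open U g.
Proof. by move=> oU fg /smooth_openP df; apply/smooth_openP => k; exact: upto_ext (df k). Qed.

Lemma smooth_open_sub V W (U U' : set V) (f : V -> W) : U' `<=` U ->
  smooth_open U f -> smooth_open U' f.
Proof. by move=> UU' df s x /UU'; exact: df. Qed.

Lemma smooth_cst V W (U : set V) (c : W) : smooth_open U (cst c).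
Proof. by apply/smooth_openP => k; exact: upto_cst. Qed.

Lemma smooth_linear V W (U : set V) (l : V -> W) : linear l -> continuous l ->
  smooth_open U l.
Proof. by move=> ll lc; apply/smooth_openP => k; exact: upto_linear. Qed.

Lemma smooth_add V W (U : set V) (f g : V -> W) : open U ->
  smooth_open U f -> smooth_open U g -> smooth_open U (fun x => f x + g x).
Proof.
move=> oU /smooth_openP df /smooth_openP dg.
by apply/smooth_openP => k; exact: upto_add.
Qed.

Lemma smooth_sum V W (U : set V) (I : Type) (r : seq I) (F : I -> V -> W) : open U ->
  (forall i, smooth_open U (F i)) -> smooth_open U (fun x => \sum_(i <- r) F i x).
Proof.
move=> oU dF; apply/smooth_openP => k; apply: upto_sum => // i.
exact: (smooth_openP _ _).1 (dF i) k.
Qed.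

Lemma smooth_scale V W (U : set V) (s : V -> R) (f : V -> W) : open U ->
  smooth_open U s -> smooth_open U f -> smooth_open U (fun x => s x *: f x).
Proof.
move=> oU /smooth_openP ds /smooth_openP df.
by apply/smooth_openP => k; exact: upto_scale.
Qed.

Lemma smooth_pair V W1 W2 (U : set V) (f : V -> W1) (g : V -> W2) : open U ->
  smooth_open U f -> smooth_open U g -> smooth_open U (fun x => (f x, g x)).
Proof.
move=> oU /smooth_openP df /smooth_openP dg.
by apply/smooth_openP => k; exact: upto_pair.
Qed.

Lemma smooth_comp V1 V2 V3 (U : set V1) (U' : set V2) (f : V1 -> V2) (g : V2 -> V3) :
  finite_frame V2 -> open U -> (forall x, U x -> U' (f x)) ->
  smooth_open U f -> smooth_open U' g -> smooth_open U (g \o f).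
Proof.
move=> fr oU fU /smooth_openP df /smooth_openP dg; apply/smooth_openP => k.
exact: (upto_comp (U' := U')).
Qed.

Lemma smooth_derive V W (U : set V) (f : V -> W) v :
  smooth_open U f -> smooth_open U ('D_v f).
Proof.
by move=> /smooth_openP df; apply/smooth_openP => k; case: (df k.+1) => _ /(_ v).
Qed.

End SmoothCalculus.

(** * Trigonometric and flat functions *)

Section OneVariable.
Context (R : realType).
Let oT : open [set: R] := openT.

(** In one variable D_v f = v f', hence one more derivative of f amounts to the
    differentiability of f' to the previous order. *)
Lemma upto_primitive k (f df : R -> R) : (forall x, is_derive x (1 : R) f (df x)) ->
  differentiable_upto k [set: R] df -> differentiable_upto k.+1 [set: R] f.
Proof.
move=> fE dfk; split=> [x _|v]; first by apply/derivable1_diffP; exact: ex_derive.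
apply: upto_ext (upto_scale oT (upto_cst k _ (v : R)) dfk) => // x _.
have dfx : differentiable f x by apply/derivable1_diffP; exact: ex_derive.
rewrite /cst deriveE//= -[v in RHS]mulr1 linearZ/= -deriveE//.
by congr (_ *: _); rewrite derive_val.
Qed.

Lemma upto_sin_cos k :
  differentiable_upto k [set: R] (sin : R -> R) /\ differentiable_upto k [set: R] (cos : R -> R).
Proof.
elim: k => [|k [sk ck]].
  by split; split=> // x _; apply/derivable1_diffP; exact: ex_derive.
split; first exact: upto_primitive ck.
apply: (upto_primitive (df := fun x => - sin x)).
apply: upto_ext (upto_scale oT (upto_cst k _ (-1 : R)) sk) => // x _.
by rewrite /cst scaleN1r.
Qed.

Lemma smooth_sin : smooth_open [set: R] (sin : R -> R).
Proof. by apply/smooth_openP => k; case: (upto_sin_cos k). Qed.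

Lemma smooth_cos : smooth_open [set: R] (cos : R -> R).
Proof. by apply/smooth_openP => k; case: (upto_sin_cos k). Qed.

(** The family is closed under derivation up to linear combinations, see
    is_derive_flat; flat 0 is the usual function exp(-1/x). *)
Definition flat n (x : R) : R := if 0 < x then x^-1 ^+ n * expR (- x^-1) else 0.

Lemma flat_pos n x : 0 < x -> 0 < flat n x.
Proof. by move=> x0; rewrite /flat x0 mulr_gt0 ?expR_gt0// exprn_gt0// invr_gt0. Qed.

Lemma flat_neg n x : x <= 0 -> flat n x = 0.
Proof. by move=> x0; rewrite /flat ltNge x0. Qed.

(** With y = 1/x this is y^(n+1) <= (n+1)! exp y, one term of the exponential
    series. It gives all the decay at 0 that smoothness needs. *)
Lemma flat_le n x : `|flat n x| <= n.+1`!%:R * `|x|.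
Proof.
rewrite /flat; case: ltP => x0; last by rewrite normr0 mulr_ge0.
have xi0 : 0 < x^-1 by rewrite invr_gt0.
rewrite !gtr0_norm ?mulr_gt0 ?expR_gt0 ?exprn_gt0// expRN.
rewrite ler_pdivrMr ?expR_gt0//.
have := expR_ge1Dxn n (ltW xi0).
set E := expR _; set F := _`!%:R => H.
have F0 : 0 < F by rewrite ltr0n fact_gt0.
have {}H : x^-1 ^+ n.+1 <= F * E.
  by rewrite mulrC -ler_pdivrMr//; apply: le_trans H; rewrite lerDr.
rewrite mulrAC -ler_pdivrMr//.
by rewrite -exprSr.
Qed.

Lemma flat_shift n x : x != 0 -> x^-1 * flat n x = flat n.+1 x.
Proof. by move=> x0; rewrite /flat; case: ltP => // _; rewrite ?mulr0// mulrA exprS. Qed.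

Lemma flat_cvg0 n : flat n x @[x --> 0^'] --> (0:R).
Proof.
apply/norm_cvg0P; apply: (@squeeze_cvgr _ _ _ _ (fun=> 0) (fun x => n.+1`!%:R * `|x|)).
- by near=> x; rewrite normr_ge0 flat_le.
- exact: cvg_cst.
- rewrite -[X in _ --> X](mulr0 (n.+1`!%:R)); apply: cvgMr.
  rewrite -[X in _ --> X](normr0 R); apply: cvg_norm; exact: cvg_within.
Unshelve. all: by end_near. Qed.

(** Away from 0 this is the product rule; at 0 the difference quotient of flat n
    is flat n.+1, which tends to 0. *)
Lemma is_derive_flat n (x : R) :
  is_derive x (1 : R) (flat n) (flat n.+2 x - n%:R * flat n.+1 x).
Proof.
have [x0|x0|->] := ltgtP x 0.
- rewrite !(flat_neg _ (ltW x0)) mulr0 subr0.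
  apply: (@near_eq_is_derive _ _ _ (cst (0:R))).
  by near=> y; rewrite flat_neg//; apply: ltW; near: y; exact: lt_nbhsl.
- have xn0 : x != 0 by rewrite gt_eqF.
  have dV : is_derive x (1:R) (fun y : R => y^-1) (- x^-1 ^+ 2).
    have di := @derivable_id R R x 1.
    have [dx eV] := (derivableV (f := id) xn0 di, deriveV (f := id) xn0 di).
    by apply: DeriveDef => //; rewrite [LHS]eV derive_id [LHS]mulr1 exprVn.
  have dE : is_derive x (1:R) (expR \o (fun y : R => - y^-1)) (expR (- x^-1) * x^-1 ^+ 2).
    have dNV := is_deriveN dV; rewrite opprK in dNV.
    exact: is_derive1_comp.
  have dM := is_deriveM (is_deriveX n dV) dE.
  have -> : flat n.+2 x - n%:R * flat n.+1 x =
     ((fun y : R => y^-1) ^+ n) x *: (expR (- x^-1) * x^-1 ^+ 2) +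
     (expR \o (fun y : R => - y^-1)) x *: ((n%:R * x^-1 ^+ n.-1) *: - x^-1 ^+ 2).
    rewrite /flat x0 exprfctE /= /GRing.scale/=.
    by case: n {dM} => [|m] /=; rewrite ?exprS; ring.
  apply: near_eq_is_derive dM; near=> y.
  rewrite /flat ifT ?exprfctE//; near: y; exact: lt_nbhsr.
rewrite !flat_neg// mulr0 subr0.
have flat_slope : (fun h => h^-1 *: ((flat n \o shift 0) (h *: 1) - flat n 0)) @ 0^' --> (0:R).
  apply: cvg_trans (flat_cvg0 n.+1); apply: near_eq_cvg; near=> h.
  rewrite /= addr0 [_ *: 1]mulr1 (flat_neg _ (lexx 0)) subr0 [_ *: _]flat_shift//.
  by near: h; exact: nbhs_dnbhs_neq.
by apply: DeriveDef; [apply/cvg_ex; exists 0|exact: cvg_lim flat_slope].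
Unshelve. all: by end_near. Qed.

Lemma upto_flat k n : differentiable_upto k [set: R] (flat n).
Proof.
elim: k n => [|k IH] n.
  split=> // x _; apply/derivable1_diffP.
  exact: (@ex_derive _ _ _ _ _ _ _ (is_derive_flat n x)).
apply: upto_primitive (is_derive_flat n) _.
apply: upto_ext (upto_add oT (IH n.+2)
  (upto_scale oT (upto_cst k _ (- n%:R : R)) (IH n.+1))) => // x _.
by rewrite /cst scaleNr.
Qed.

Lemma smooth_flat n : smooth_open [set: R] (flat n).
Proof. by apply/smooth_openP => k; exact: upto_flat. Qed.
End OneVariable.

(** * Maps with compact support are Lipschitz *)

Section CompactSupport.
Context (R : realType).
Implicit Types V W : normedModType R.

Lemma compact_support_bounded V W (K : set V) (f : V -> W) : compact K -> continuous f ->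
  (forall x, ~ K x -> f x = 0) -> exists2 M, 0 < M & forall x, `|f x| <= M.
Proof.
move=> Kc fc f0.
have : bounded_set (f @` K) by apply/compact_bounded/continuous_compact => //; exact: continuous_subspaceT.
move=> [M [_ /(_ (`|M| + 1))fM]].
exists (`|M| + 1) => [|x]; first by rewrite ltr_wpDl.
have [Kx|nKx] := pselect (K x); last by rewrite f0// normr0 addr_ge0.
by apply: fM; [rewrite ltr_pwDr// ler_norm | exists x].
Qed.

Lemma smooth_derive_continuous V W (f : V -> W) v :
  smooth_open setT f -> continuous ('D_v f).
Proof.
move=> sf x; apply: differentiable_continuous.
exact: smooth_open_diff (smooth_derive v sf) I.
Qed.

(** Expand the differential in a frame: each partial derivative is continuous and
    vanishes off the support, hence is bounded. *)
Lemma compact_support_diff_le V (K : set V) (g : V -> R) : finite_frame V ->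
  compact K -> smooth_open setT g -> (forall x, ~ K x -> g x = 0) ->
  exists2 M, 0 < M & forall x v, `|'d g x v| <= M * `|v|.
Proof.
move=> [B [e [l [ll lc eE]]]] Kc sg g0.
have Kcl : closed K by apply: compact_closed => //; exact: norm_hausdorff.
have Di i : exists M, 0 < M /\ forall x v, `|l i v * 'D_(e i) g x| <= M * `|v|.
  have [|M M0 DM] := compact_support_bounded Kc (smooth_derive_continuous (v := e i) sg).
    move=> x nKx; rewrite -(derive_cst (0:R) x (e i)); apply: near_eq_derive.
    by apply: filterS (open_nbhs_nbhs (conj (closed_openC Kcl) nKx)).
  have [L LE] := linear_pack (ll i).
  have Lc : continuous L by rewrite -LE; exact: lc.
  have [k k0 lk] := linear_lipschitz Lc.
  exists (k * M); split=> [|x v]; first exact: mulr_gt0.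
  by rewrite LE normrM mulrAC ler_pM.
have [M MP] := choice Di.
exists (1 + \sum_i M i) => [|x v].
  by rewrite ltr_pwDl// sumr_ge0// => i _; apply: ltW; case: (MP i).
have dg : differentiable g x by exact: (sg [::] x I).
rewrite [in leLHS](eE v) linear_sum.
apply: le_trans (ler_norm_sum _ _ _) _.
rewrite mulrDl mul1r ler_wpDl// mulr_suml; apply: ler_sum => i _.
rewrite linearZ/= -deriveE//; exact: (MP i).2.
Qed.

(** Mean value theorem along the segment from y to x. *)
Lemma diff_le_lipschitz V (g : V -> R) M :
  (forall x, differentiable g x) -> (forall x v, `|'d g x v| <= M * `|v|) ->
  forall x y, `|g x - g y| <= M * `|x - y|.
Proof.
move=> dg gM x y.
pose s (t : R) := t *: (x - y) + y.
have ds t : is_diff t s ( *:%R^~ (x - y)).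
  by apply: is_diff_eq; rewrite addr0.
have gs t : is_derive t (1:R) (g \o s) ('d g (s t) (x - y)).
  have dst := @ex_diff _ _ _ _ _ _ _ (ds t).
  apply: DeriveDef; first by apply: diff_derivable; exact: differentiable_comp.
  rewrite deriveE; last exact: differentiable_comp.
  by rewrite diff_comp// (@diff_val _ _ _ _ _ _ _ (ds t))/= scale1r.
have [|c _] := @MVT_segment R (g \o s) (fun t => 'd g (s t) (x - y)) 0 1 ler01.
  apply/continuous_subspaceT => t; apply: differentiable_continuous.
  by apply/derivable1_diffP; exact: (@ex_derive _ _ _ _ _ _ _ (gs t)).
rewrite /s/= scale1r scale0r add0r subrK subr0 mulr1 => ->.
exact: gM.
Qed.

Lemma compact_support_lipschitz V W (K : set V) (F : V -> W) :
  finite_frame V -> finite_frame W ->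
  compact K -> smooth_open setT F -> (forall x, ~ K x -> F x = 0) ->
  exists2 M, 0 < M & (forall x, `|F x| <= M) /\ forall x y, `|F x - F y| <= M * `|x - y|.
Proof.
move=> fV [B [e [l [ll lc eE]]]] Kc sF F0.
have [M0 M00 FM0] := compact_support_bounded Kc (fun x => differentiable_continuous (sF [::] x I)) F0.
have lF i : exists M, 0 < M /\ forall x y, `|l i (F x) - l i (F y)| <= M * `|x - y|.
  have [L LE] := linear_pack (ll i).
  have slF : smooth_open setT (l i \o F).
    by apply/smooth_openP => k; apply: upto_linear_comp => //;
      [exact: openT|exact: (smooth_openP _ _).1].
  have [|M MM dM] := compact_support_diff_le fV Kc slF.
    by move=> x /F0 /= ->; rewrite LE linear0.
  exists M; split=> //; apply: diff_le_lipschitz dM.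
  by move=> x; exact: (slF [::] x I).
have [M MP] := choice lF.
have S0 : 0 <= \sum_i M i * `|e i|.
  by apply: sumr_ge0 => i _; rewrite mulr_ge0// ltW//; case: (MP i).
exists (M0 + \sum_i M i * `|e i|); first by rewrite ltr_pwDl.
split=> [x|x y]; first by rewrite (le_trans (FM0 x))// lerDl.
rewrite mulrDl ler_wpDl ?mulr_ge0 ?(ltW M00)//.
rewrite (eE (F x)) (eE (F y)) -sumrB mulr_suml.
apply: le_trans (ler_norm_sum _ _ _) _; apply: ler_sum => i _.
rewrite -scalerBl normrZ mulrAC ler_wpM2r//; exact: (MP i).2.
Qed.

End CompactSupport.

(** * Closed embeddings of the ambient space *)

(** The properties of a self-map of the ambient space that make it carry proper
    embeddings to proper embeddings. They are stable under composition and hold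
    for diffeomorphisms as well as for small perturbations of the identity, so
    that no inverse of the latter has to be constructed. *)
Record closed_embedding (R : realType) (V : normedModType R) (F : V -> V) : Prop := ClosedEmbedding {
  emb_smooth : smooth_open setT F ;
  emb_immersion : forall x, injective ('d F x) ;
  emb_injective : injective F ;
  emb_open : forall O, open O -> exists2 O', open O' & F @^-1` O' = O ;
  emb_proper : forall K, compact K -> compact (F @^-1` K) }.

Section ClosedEmbeddings.
Context (R : realType).

Lemma J1_frame n : finite_frame (J1 R n : normedModType R).
Proof. by apply: frame_prod; [apply: frame_prod; exact: frame_rV|exact: frame_R]. Qed.

Lemma rV_closed_ball_compact n (r : R) : compact [set v : 'rV[R]_n | `|v| <= r].
Proof.
apply: bounded_closed_compact.
  by exists r; split=> [|s rs v /= /le_trans]; [exact: num_real|apply; exact: ltW].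
rewrite (_ : mkset _ = (Num.norm : 'rV[R]_n -> R) @^-1` [set x | x <= r])//.
apply: closed_comp; last exact: closed_le.
by move=> x _; exact: norm_continuous.
Qed.

Lemma J1_closed_ball_compact n (r : R) : compact [set x : J1 R n | `|x| <= r].
Proof.
have -> : [set x : J1 R n | `|x| <= r] =
    ([set v : 'rV[R]_n | `|v| <= r] `*` [set v : 'rV[R]_n | `|v| <= r]) `*`
      [set z : R | `|z| <= r].
  apply/seteqP; split=> -[[q p] z] /=; rewrite !prod_normE/= !ge_max.
    by move=> /andP[/andP[]].
  by move=> [[-> ->] ->].
apply: compact_setX; first by apply: compact_setX; exact: rV_closed_ball_compact.
have -> : [set z : R | `|z| <= r] = [set` `[(- r), r]].
  by apply/seteqP; split=> z /=; rewrite in_itv/= ler_norml.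
exact: segment_compact.
Qed.

Lemma J1_hausdorff n : hausdorff_space (J1 R n).
Proof. exact: norm_hausdorff. Qed.

Lemma closed_embedding_comp n (F G : J1 R n -> J1 R n) :
  closed_embedding F -> closed_embedding G -> closed_embedding (G \o F).
Proof.
move=> [sF iF jF openF pF] [sG iG jG openG pG]; split.
- exact: (smooth_comp (U' := setT) (J1_frame n) openT).
- move=> x.
  rewrite diff_comp; [|exact: (sF [::] x I)|exact: (sG [::] _ I)].
  exact: inj_comp.
- exact: inj_comp.
- move=> U /openF [U1 /openG [U2 oU2 <-] <-]; by exists U2.
- by move=> K /pG/pF.
Qed.

(** The differential of the inverse map is a left inverse. *)
Lemma diffeomorphism_diffK n (f : J1 R n -> J1 R n) x : diffeomorphism f -> injective ('d f x).
Proof.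
move=> [sf [g [sg fg gf]]] u v uv.
have df : differentiable f x by exact: (sf [::] x I).
have dg : differentiable g (f x) by exact: (sg [::] (f x) I).
have E w : 'd g (f x) ('d f x w) = w.
  rewrite -[LHS]/(('d g (f x) \o 'd f x) w) -diff_comp//.
  rewrite (_ : g \o f = id); first by rewrite diff_val.
  by apply/funext => y /=; rewrite fg.
exact: etrans (esym (E u)) (etrans (congr1 ('d g (f x)) uv) (E v)).
Qed.

Lemma diffeomorphism_closed_embedding n (f : J1 R n -> J1 R n) :
  diffeomorphism f -> closed_embedding f.
Proof.
move=> df; have [sf [g [sg fg gf]]] := df; split=> //.
- by move=> x; exact: diffeomorphism_diffK.
- exact: can_inj fg.
- move=> O oO; exists (g @^-1` O).
    apply: open_comp => // x _; apply: differentiable_continuous; exact: (sg [::] x I).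
  by apply/seteqP; split => x /=; rewrite fg.
- move=> K Kc; rewrite (_ : f @^-1` K = g @` K).
    apply: continuous_compact => //; apply: continuous_subspaceT => x.
    apply: differentiable_continuous; exact: (sg [::] x I).
  apply/seteqP; split=> [x /= Kx|_ [x Kx <-]/=]; last by rewrite gf.
  by exists (f x).
Qed.

Lemma lipschitz_diff_le (V W : normedModType R) (P : V -> W) (k : R) x :
  differentiable P x -> (forall x y, `|P x - P y| <= k * `|x - y|) ->
  forall v, `|'d P x v| <= k * `|v|.
Proof.
move=> dP kP v; rewrite -deriveE//.
have Pv : derivable P x v by exact: diff_derivable.
have : `|h^-1 *: ((P \o shift x) (h *: v) - P x)| @[h --> 0^'] --> `|'D_v P x|.
  by apply: cvg_norm; exact: Pv.
move=> /cvgr_to_le; apply.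
near=> h.
have h0 : h != 0 by near: h; exact: nbhs_dnbhs_neq.
rewrite normrZ normfV ler_pdivrMl ?normr_gt0//.
by rewrite (le_trans (kP _ _))// addrK normrZ mulrCA.
Unshelve. all: by end_near. Qed.

(** The half-Lipschitz bound on P gives |x - y| <= 2 |F x - F y| for F = id + P,
    from which injectivity, injectivity of the differential and openness onto the
    image follow. As P is bounded, preimages of bounded sets are bounded, which
    yields properness. *)
Lemma small_perturbation_closed_embedding n (P : J1 R n -> J1 R n) (M : R) :
  smooth_open setT P -> (forall x, `|P x| <= M) ->
  (forall x y, `|P x - P y| <= 2^-1 * `|x - y|) ->
  closed_embedding (fun x => x + P x).
Proof.
move=> sP PM PL.
set F := fun x => _.
have sF : smooth_open setT F.
  apply: (smooth_add (f := id)) => //; first exact: openT.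
  by apply: smooth_linear => // x.
have Fc : continuous F by move=> x; apply: differentiable_continuous; exact: (sF [::] x I).
have expand x y : `|x - y| <= 2 * `|F x - F y|.
  have -> : x - y = (F x - F y) - (P x - P y) by rewrite /F opprD addrACA addrK.
  have := ler_normB (F x - F y) (P x - P y); have := PL x y.
  have -> : (F x - F y) - (P x - P y) = x - y by rewrite /F opprD addrACA addrK.
  lra.
split=> //.
- move=> x u v uv; apply/eqP; rewrite -subr_eq0 -normr_le0.
  have dP : differentiable P x by exact: (sP [::] x I).
  have dF0 : 'd F x (u - v) = 0 by rewrite linearB/= uv subrr.
  have [_ dFE] : is_diff x F (id + 'd P x).
    have idd : is_diff x (@id (J1 R n)) id by exact: is_diff_id.
    have Pd : is_diff x P ('d P x) by exact: DiffDef.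
    exact: is_diffD.
  have /eqP := etrans (esym (congr1 (fun h => h (u - v)) dFE)) dF0.
  rewrite addr_eq0 => /eqP/= e.
  by have := lipschitz_diff_le dP PL (u - v); rewrite -normrN -e; lra.
- move=> x y Fxy; apply/eqP; rewrite -subr_eq0 -normr_le0.
  by rewrite (le_trans (expand x y))// Fxy subrr normr0 mulr0.
- move=> O oO.
  (* The largest open set whose preimage lies in O. *)
  exists (\bigcup_(B in [set B : set (J1 R n) | open B /\ F @^-1` B `<=` O]) B).
    by apply: bigcup_open => B [].
  apply/seteqP; split=> [x [B [_ BO] /BO]//|x Ox].
  have /nbhs_ballP[e /= e0 eO] := open_nbhs_nbhs (conj oO Ox).
  exists (ball (F x) (e / 2)); last by apply: ballxx; rewrite divr_gt0.
  split; first exact: ball_open.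
  move=> y; rewrite /= -ball_normE/= => Fxy; apply: eO.
  by rewrite -ball_normE/= (le_lt_trans (expand x y))// mulrC -ltr_pdivlMr.
- move=> K Kc.
  have Kcl : closed K by apply: compact_closed Kc; exact: J1_hausdorff.
  have [r [_ Kr]] := compact_bounded Kc.
  apply: (subclosed_compact _ (@J1_closed_ball_compact n (`|r| + 1 + M))) => [|x /= FKx].
    by apply: closed_comp => // x _; exact: Fc.
  have -> : x = F x - P x by rewrite /F addrK.
  rewrite (le_trans (ler_normB _ _))// lerD//.
  by apply: Kr => //; rewrite ltr_pwDr// ler_norm.
Qed.

End ClosedEmbeddings.

(** * Bump functions and proper embeddings *)

Section ProperEmbeddings.
Context (R : realType).
Implicit Types V W : normedModType R.

(** Take exp(-1/s), extended by 0 where s <= 0, with s(x) = S minus the sum of the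
    squared coordinates. In a frame, coordinates are bounded by the norm and
    conversely, so s is positive on the given ball for S large, and s(x) > 0 bounds
    the norm of x. *)
Lemma smooth_bump V (r0 : R) : finite_frame V ->
  exists (rho : V -> R) (r : R), [/\ smooth_open setT rho, forall x, 0 <= rho x,
     forall x, `|x| <= r0 -> 0 < rho x & forall x, r < `|x| -> rho x = 0].
Proof.
move=> [B [e [l [ll lc eE]]]].
have lM i : exists M, forall x, `|x| <= r0 -> l i x ^+ 2 <= M ^+ 2.
  have [L LE] := linear_pack (ll i).
  have [k k0 kl] := linear_lipschitz (f := L) ltac:(by rewrite -LE).
  exists (k * r0) => x xr.
  rewrite -real_normK ?num_real// ler_sqr ?nnegrE// ?mulr_ge0 ?(ltW k0) ?(le_trans _ xr)//.
  by rewrite LE (le_trans (kl x))// ler_wpM2l// ltW.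
have [M MP] := choice lM.
pose S := 1 + \sum_i M i ^+ 2.
pose s x := S + (-1) *: \sum_i (l i x *: l i x).
exists (flat 0 \o s), (\sum_i S * `|e i|).
have S1 : 1 <= S by rewrite lerDl sumr_ge0// => i _; exact: sqr_ge0.
split.
- have oT : open [set: V] by exact: openT.
  apply: (smooth_comp (U' := setT) (frame_R R) oT) => //; last exact: smooth_flat.
  apply: smooth_add => //; first exact: smooth_cst.
  apply: smooth_scale => //; first exact: smooth_cst.
  apply: smooth_sum => // i.
  by apply: smooth_scale => //; exact: smooth_linear.
- move=> x /=; have [s0|s0] := ltP 0 (s x); first exact/ltW/flat_pos.
  by rewrite flat_neg.
- move=> x xr /=; apply: flat_pos; rewrite /s scaleN1r subr_gt0.
  rewrite /S ltr_pwDl// ler_sum// => i _.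
  by rewrite -[_ *: _]expr2; exact: MP.
- move=> x /=; rewrite ltNge => nx; apply: flat_neg; rewrite leNgt.
  apply: contra nx => s0; rewrite [in leLHS](eE x).
  apply: le_trans (ler_norm_sum _ _ _) _; apply: ler_sum => i _.
  rewrite normrZ ler_wpM2r// leNgt; apply/negP => lS.
  move: s0; rewrite /s scaleN1r subr_gt0 ltNge => /negP; apply.
  apply: (@le_trans _ _ (l i x ^+ 2)).
    rewrite -real_normK ?num_real// expr2.
    by rewrite (le_trans (ltW lS))// ler_peMl// (le_trans S1)// ltW.
  rewrite (bigD1 i)//= -[_ *: _ in leRHS]expr2 lerDl sumr_ge0// => j _.
  by rewrite -[_ *: _]expr2 sqr_ge0.
Qed.

Lemma smooth_on_open V W (A : set V) (f : V -> W) : open A -> smooth_on A f -> smooth_open A f.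
Proof.
move=> oA sf s x Ax; have [U [g [oU Ux sg gf]]] := sf x Ax.
suff : smooth_open (U `&` A) f by apply.
apply: (smooth_open_ext (f := g)); [exact: openI|by move=> y []; exact: gf|].
apply: smooth_open_sub sg; exact: subIsetl.
Qed.

Lemma closed_embedding_diff V (F : V -> V) x : closed_embedding F -> differentiable F x.
Proof. by move=> /emb_smooth/(_ [::] x I). Qed.

Lemma closed_embedding_continuous V (F : V -> V) : closed_embedding F -> continuous F.
Proof. by move=> eF x; apply: differentiable_continuous; exact: closed_embedding_diff. Qed.

Lemma proper_embedding_comp n m (L : smooth_manifold R m) (f : L -> J1 R n)
    (F : J1 R n -> J1 R n) :
  proper_embedding f -> closed_embedding F -> proper_embedding (fun p => F (f p)).
Proof.
move=> [sf imf [injf tf] pf] eF; have Fc := closed_embedding_continuous eF; split.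
- move=> c ac a Aa; have [U [g [oU Ua sg gf]]] := sf c ac a Aa.
  exists U, (F \o g); split=> //.
    apply: (smooth_comp (U' := setT) (J1_frame R n) oU) => //; exact: emb_smooth eF.
  by move=> x Ux Ax /=; rewrite gf.
- move=> c p ac cp.
  have sfc := smooth_on_open (cimg_open (c := c)) (sf c ac).
  have df : differentiable (f \o cinv c) (cmap c p) by apply: (sfc [::]); exists p.
  have -> : chart_diff (fun p => F (f p)) c p = 'd F ((f \o cinv c) (cmap c p)) \o chart_diff f c p.
    exact: (diff_comp df (closed_embedding_diff _ eF)).
  by apply: inj_comp; [exact: emb_immersion|exact: imf].
- split; first by move=> p q /(emb_injective eF)/injf.
  move=> U; split=> [/tf[V oV <-]|[V oV <-]].
    by have [V' oV' <-] := emb_open eF oV; exists V'.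
  by apply/tf; exists (F @^-1` V) => //; apply: open_comp.
- move=> K Kc.
  rewrite (_ : _ `&` _ = F @` (range f `&` F @^-1` K)).
    apply: continuous_compact; last exact/pf/(emb_proper eF).
    exact: continuous_subspaceT.
  apply/seteqP; split=> [_ [[p _ <-] Kp]|_ [_ [[p _ <-] /= Kp] <-]].
    by exists (f p).
  by split=> //; exists p.
Qed.

(** A topological embedding is a homeomorphism onto its image, so a covering
    property of the image pulls back to the source. *)
Lemma topological_embedding_compact_preimage n m (L : smooth_manifold R m) (f : L -> J1 R n)
    (K : set (J1 R n)) :
  topological_embedding f -> compact (range f `&` K) -> compact (f @^-1` K).
Proof.
move=> [injf tf] /compact_near_coveringP Kc; apply/compact_near_coveringP => I' F P FF PK.
have := Kc I' F (fun i x => forall p, f p = x -> P i p) FF.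
move=> /(_ _)/filterS; apply.
  by move=> i iP p fKp; apply: (iP (f p)) => //; split=> //; exists p.
move=> _ [[p _ <-] Kp].
have [[/= A B] [nA FB] AB] := PK p Kp.
move: nA; rewrite nbhsE => -[A' [/tf[U oU UA'] A'p] A'A].
exists (U, B) => /=.
  by split=> //; apply: open_nbhs_nbhs; split=> //; rewrite -[U (f p)]/((f @^-1` U) p) UA'.
move=> [x i] /= [Ux Bi] q qx; apply: (AB (q, i)); split=> //=; apply: A'A.
by rewrite -UA' /= qx.
Qed.

End ProperEmbeddings.

(** * Small positive loops *)

Section Loop.
Context (R : realType) (n : nat) (i0 : 'I_n) (rho : J1 R n -> R).

Definition reeb : J1 R n := (0, 0, 1).
Definition loop_q (x : J1 R n) : J1 R n := rho x *: (delta_mx 0 i0, 0, x.1.2 0 i0).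
Definition loop_p (x : J1 R n) : J1 R n := rho x *: (0, delta_mx 0 i0, 0).
Definition loop_z (x : J1 R n) : J1 R n := rho x *: (rho x *: reeb).

(** Displacement of x along the loop, of size e and angular speed w. The
    coordinates (q_i0, p_i0) turn around a circle through their initial position;
    the z component of loop_q compensates the term p dq of the contact form at x,
    and the last summand makes the speed constant, see contact_form_loop_shift. *)
Definition loop_shift (e w t : R) (x : J1 R n) : J1 R n :=
  (e * (1 - cos (w * t))) *: loop_q x + (- (e * sin (w * t))) *: loop_p x +
  (e ^+ 2 / 2 * (sin (w * t) * cos (w * t))) *: loop_z x.

Definition loop_velocity (e w t : R) (x : J1 R n) : J1 R n :=
  (e * w * sin (w * t)) *: loop_q x + (- (e * w * cos (w * t))) *: loop_p x +
  (e ^+ 2 / 2 * (w * (cos (w * t) ^+ 2 - sin (w * t) ^+ 2))) *: loop_z x.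

Lemma is_derive_scale_cst (V : normedModType R) (a : R -> R) da t (v : V) :
  is_derive t (1 : R) a da -> is_derive t (1 : R) (fun s => a s *: v) (da *: v).
Proof.
move=> Da.
have da' : differentiable a t by apply/derivable1_diffP; exact: ex_derive.
have dav : differentiable (fun s => a s *: v) t by exact: differentiableZl.
apply: DeriveDef; first exact: diff_derivable.
by rewrite deriveE// diffZl//= -deriveE// derive_val.
Qed.

Lemma is_derive_loop_shift e w t x :
  is_derive t (1 : R) (fun s => x + loop_shift e w s x) (loop_velocity e w t x).
Proof.
have dw : is_derive t (1 : R) (fun s => w * s) w.
  have := is_deriveZ w (is_derive_id t (1 : R)).
  by rewrite [w *: 1]mulr1.
have dsin : is_derive t (1 : R) (fun s => sin (w * s)) (cos (w * t) * w).
  exact: (is_derive1_comp (f := sin)).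
have dcos : is_derive t (1 : R) (fun s => cos (w * s)) (- sin (w * t) * w).
  exact: (is_derive1_comp (f := cos)).
have da : is_derive t (1 : R) (fun s => e * (1 - cos (w * s))) (e * w * sin (w * t)).
  have := is_deriveZ e (is_deriveB (is_derive_cst (1 : R) t (1 : R)) dcos).
  by rewrite sub0r (_ : _ *: _ = e * w * sin (w * t))//= /GRing.scale/=; ring.
have db : is_derive t (1 : R) (fun s => - (e * sin (w * s))) (- (e * w * cos (w * t))).
  have := is_deriveN (is_deriveZ e dsin).
  by rewrite (_ : - (_ *: _) = - (e * w * cos (w * t)))//= /GRing.scale/=; ring.
have dc : is_derive t (1 : R) (fun s => e ^+ 2 / 2 * (sin (w * s) * cos (w * s)))
    (e ^+ 2 / 2 * (w * (cos (w * t) ^+ 2 - sin (w * t) ^+ 2))).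
  have := is_deriveZ (e ^+ 2 / 2) (is_deriveM dsin dcos).
  rewrite (_ : _ *: _ = e ^+ 2 / 2 * (w * (cos (w * t) ^+ 2 - sin (w * t) ^+ 2)))//= /GRing.scale/=; ring.
have := is_deriveD (is_deriveD (is_derive_scale_cst (loop_q x) da)
  (is_derive_scale_cst (loop_p x) db)) (is_derive_scale_cst (loop_z x) dc).
move=> /(is_deriveD (is_derive_cst x t (1 : R))).
by rewrite add0r.
Qed.

(** The z component of loop_q cancels the term p dq, so that
    (c' - b a') rho^2 remains, where a, b, c are the three coefficients of
    loop_shift; the oscillating terms then cancel because cos^2 + sin^2 = 1. *)
Lemma contact_form_loop_shift e w t x :
  contact_form (x + loop_shift e w t x) (loop_velocity e w t x) = e ^+ 2 * w / 2 * rho x ^+ 2.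
Proof.
rewrite /contact_form (bigD1 i0)//= big1 ?addr0 => [|i ii0]; last first.
  by rewrite !mxE (negbTE ii0) andbF /GRing.scale /= !(mulr0, addr0).
rewrite !mxE !eqxx /= /GRing.scale/=.
have := cos2Dsin2 (w * t); set C := cos _; set S := sin _ => CS.
have -> : C ^+ 2 = 1 - S ^+ 2 by rewrite -CS addrK.
by field.
Qed.

Lemma loop_shift0 e w x : loop_shift e w 0 x = 0.
Proof. by rewrite /loop_shift mulr0 cos0 sin0 subrr !mulr0 mul0r mulr0 oppr0 !scale0r !addr0. Qed.

Lemma loop_shift1 e N x : loop_shift e (pi *+ 2 *+ N) 1 x = 0.
Proof.
rewrite /loop_shift mulr1.
have -> : cos (pi *+ 2 *+ N) = 1 :> R.
  by rewrite -[X in cos X]add0r (periodicn (@cosD2pi R)) cos0.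
have -> : sin (pi *+ 2 *+ N) = 0 :> R.
  by rewrite -[X in sin X]add0r (periodicn (@sinD2pi R)) sin0.
by rewrite subrr !mulr0 mul0r mulr0 oppr0 !scale0r !addr0.
Qed.

Lemma loop_shift_rho0 e w t x : rho x = 0 -> loop_shift e w t x = 0.
Proof. by rewrite /loop_shift /loop_q /loop_p /loop_z => ->; rewrite !scale0r !scaler0 !addr0. Qed.

Hypothesis smooth_rho : smooth_open setT rho.

Let oT (V : normedModType R) : open [set: V]. Proof. exact: openT. Qed.

Lemma smooth_loop_q : smooth_open setT loop_q.
Proof.
apply: smooth_scale => //; apply: smooth_pair => //; first exact: smooth_cst.
apply: smooth_linear => [a x y|x]; first by rewrite /= !mxE.
apply: (@continuous_comp _ _ _ (fun x : J1 R n => x.1.2) (fun v : 'rV[R]_n => v 0 i0)).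
  apply: (@continuous_comp _ _ _ (fun x : J1 R n => x.1) snd); [exact: cvg_fst|exact: cvg_snd].
exact: coord_continuous.
Qed.

Lemma smooth_loop_p : smooth_open setT loop_p.
Proof. by apply: smooth_scale => //; exact: smooth_cst. Qed.

Lemma smooth_loop_z : smooth_open setT loop_z.
Proof. by apply: smooth_scale => //; apply: smooth_scale => //; exact: smooth_cst. Qed.

Lemma smooth_loop_shift e w :
  smooth_open setT (fun u : R * J1 R n => u.2 + loop_shift e w u.1 u.2).
Proof.
have s1 : smooth_open setT (@fst R (J1 R n)) by apply: smooth_linear => // x; exact: cvg_fst.
have s2 : smooth_open setT (@snd R (J1 R n)) by apply: smooth_linear => // x; exact: cvg_snd.
have c1 (g : R -> R) : smooth_open setT g -> smooth_open setT (fun u : R * J1 R n => g (w * u.1)).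
  move=> sg; apply: (smooth_comp (U' := setT) (frame_R R) (oT _) _ _ sg) => //.
  by apply: (smooth_scale (s := fun=> w)) => //; exact: smooth_cst.
have c2 (F : J1 R n -> J1 R n) : smooth_open setT F -> smooth_open setT (fun u : R * J1 R n => F u.2).
  by apply: smooth_comp => //; exact: J1_frame.
have ss := c1 _ (@smooth_sin R); have sc := c1 _ (@smooth_cos R).
have sk (k : R) : smooth_open setT (fun _ : R * J1 R n => k) by exact: smooth_cst.
have sm (a b : R * J1 R n -> R) : smooth_open setT a -> smooth_open setT b ->
  smooth_open setT (fun u => a u * b u) by move=> sa sb; exact: (smooth_scale (f := b)).
apply: smooth_add => //; apply: smooth_add => //; last first.
  by apply: smooth_scale => //; [apply: (sm) => //; exact: sm|exact/c2/smooth_loop_z].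
apply: smooth_add => //; apply: smooth_scale => //; try exact/c2/smooth_loop_q; try exact/c2/smooth_loop_p.
  apply: (sm) => //; apply: smooth_add => //.
  by apply: smooth_open_ext (sm _ _ (sk (-1)) sc) => // u _; rewrite mulN1r.
apply: smooth_open_ext (sm _ _ (sk (- e)) ss) => // u _; by rewrite mulNr.
Qed.

Lemma loop_shift_coeff_le e w t (q p z : J1 R n) M : 0 <= e <= 1 ->
  `|q| <= M -> `|p| <= M -> `|z| <= M ->
  `| (e * (1 - cos (w * t))) *: q + (- (e * sin (w * t))) *: p +
     (e ^+ 2 / 2 * (sin (w * t) * cos (w * t))) *: z| <= 4 * e * M.
Proof.
move=> /andP[e0 e1] qM pM zM.
have s1 := sin_max (w * t); have c1 := cos_max (w * t).
have nc1 : `|1 - cos (w * t)| <= 2 by rewrite (le_trans (ler_normB _ _))// normr1; lra.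
have sc1 : `|sin (w * t) * cos (w * t)| <= 1 by rewrite normrM mulr_ile1.
have -> : 4 * e * M = 2 * e * M + e * M + e * M by ring.
apply: le_trans (ler_normD _ _) _; apply: lerD.
  apply: le_trans (ler_normD _ _) _; apply: lerD.
    by rewrite normrZ ler_pM// normrM (ger0_norm e0) mulrC ler_wpM2r.
  by rewrite normrZ ler_pM// normrN normrM (ger0_norm e0) ler_piMr.
rewrite normrZ ler_pM// normrM ger0_norm; last by rewrite divr_ge0// exprn_ge0.
have e2 : e ^+ 2 / 2 <= e.
  have : e ^+ 2 <= e by rewrite expr2 ler_piMr.
  lra.
by rewrite (le_trans _ e2)// ler_piMr// divr_ge0// exprn_ge0.
Qed.

Lemma loop_shift_le M e w t x : 0 <= e <= 1 ->
  `|loop_q x| <= M -> `|loop_p x| <= M -> `|loop_z x| <= M ->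
  `|loop_shift e w t x| <= 4 * e * M.
Proof. exact: loop_shift_coeff_le. Qed.

Lemma loop_shift_lipschitz M e w t x y : 0 <= e <= 1 ->
  `|loop_q x - loop_q y| <= M -> `|loop_p x - loop_p y| <= M ->
  `|loop_z x - loop_z y| <= M ->
  `|loop_shift e w t x - loop_shift e w t y| <= 4 * e * M.
Proof.
move=> e01 qM pM zM; apply: le_trans (loop_shift_coeff_le w t e01 qM pM zM).
rewrite /loop_shift !scalerBr !opprD.
by rewrite addrACA [X in X + _]addrACA.
Qed.

End Loop.

Section LoopEmbedding.
Context (R : realType) (n : nat) (i0 : 'I_n) (rho : J1 R n -> R) (r : R).
Hypothesis srho : smooth_open setT rho.
Hypothesis rho0 : forall x, r < `|x| -> rho x = 0.

(** The three vector fields of the loop are bounded and Lipschitz with a common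
    constant M, and their coefficients add up to at most 4 e. *)
Lemma loop_shift_closed_embedding (d : R) : 0 < d ->
  exists e0 : R, 0 < e0 /\ forall e w, 0 <= e <= e0 ->
    (forall t x, `|loop_shift i0 rho e w t x| <= d) /\
    forall t, closed_embedding (fun x => x + loop_shift i0 rho e w t x).
Proof.
move=> d0.
have Kc := @J1_closed_ball_compact R n r.
have offK x : ~ [set x | `|x| <= r] x -> rho x = 0.
  by move=> /negP; rewrite -ltNge; exact: rho0.
have fr := J1_frame R n.
have [M1 M10 [q1 q2]] := compact_support_lipschitz fr fr Kc (smooth_loop_q i0 srho)
  ltac:(by move=> x /offK; rewrite /loop_q => ->; rewrite scale0r).
have [M2 M20 [p1 p2]] := compact_support_lipschitz fr fr Kc (smooth_loop_p i0 srho)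
  ltac:(by move=> x /offK; rewrite /loop_p => ->; rewrite scale0r).
have [M3 M30 [z1 z2]] := compact_support_lipschitz fr fr Kc (smooth_loop_z srho)
  ltac:(by move=> x /offK; rewrite /loop_z => ->; rewrite scale0r).
pose M := M1 + M2 + M3.
have M0 : 0 < M by rewrite !addr_gt0.
have [M1M M2M M3M] : [/\ M1 <= M, M2 <= M & M3 <= M] by rewrite /M; split;
  [rewrite -addrA lerDl|rewrite addrAC lerDr|rewrite lerDr]; rewrite addr_ge0// ltW.
pose e0 := Num.min 1 (Num.min d (2^-1) / (4 * M)).
have e00 : 0 < e0 by rewrite lt_min ltr01 divr_gt0 ?mulr_gt0// lt_min d0 invr_gt0 ltr0n.
exists e0; split=> // e w /andP[e_ge0 ee0].
have e01 : 0 <= e <= 1 by rewrite e_ge0 (le_trans ee0)// ge_min lexx.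
have : 4 * e * M <= Num.min d (2^-1).
  rewrite mulrAC -ler_pdivlMl ?mulr_gt0// mulrC (le_trans ee0)//.
  by rewrite ge_min lexx orbT.
rewrite le_min => /andP[ed e2].
have small t x : `|loop_shift i0 rho e w t x| <= d.
  apply: le_trans ed; apply: loop_shift_le => //.
  - exact: le_trans (q1 x) M1M.
  - exact: le_trans (p1 x) M2M.
  - exact: le_trans (z1 x) M3M.
split=> // t; apply: small_perturbation_closed_embedding => [|x|x y]; last 2 first.
- exact: small.
- apply: (@le_trans _ _ (4 * e * (M * `|x - y|))).
    have up (m : R) : m <= M -> m * `|x - y| <= M * `|x - y| by move=> mM; rewrite ler_wpM2r.
    apply: loop_shift_lipschitz => //.
    + exact: le_trans (q2 x y) (up _ M1M).
    + exact: le_trans (p2 x y) (up _ M2M).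
    + exact: le_trans (z2 x y) (up _ M3M).
  by rewrite mulrA ler_wpM2r.
have oT : open [set: J1 R n] by exact: openT.
have sc (k : R) (F : J1 R n -> J1 R n) : smooth_open setT F -> smooth_open setT (fun x => k *: F x).
  by move=> sF; apply: (smooth_scale (s := fun=> k)) => //; exact: smooth_cst.
apply: smooth_add => //; last exact/sc/smooth_loop_z.
by apply: smooth_add => //; [exact/sc/smooth_loop_q|exact/sc/smooth_loop_p].
Qed.

End LoopEmbedding.

(** The speed of the loop is of order e^2 N and its size of order e, hence the
    first can be prescribed while the second is made small. *)
Lemma loop_parameters (R : realType) (k e0 : R) : 0 < k -> 0 < e0 ->
  exists (e : R) (N : nat), 0 <= e <= e0 /\ e ^+ 2 * (pi *+ 2 *+ N) / 2 = k :> R.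
Proof.
move=> k0 e00.
have : 0 < pi :> R by exact: pi_gt0.
move: (pi : R) => c c0.
pose N := (Num.truncn (k / (c * e0 ^+ 2))).+1.
have N0 : 0 < N%:R :> R by rewrite ltr0n.
have q0 : 0 < k / (c * N%:R) by rewrite divr_gt0 ?mulr_gt0.
exists (Num.sqrt (k / (c * N%:R))), N; split; last first.
  rewrite sqr_sqrtr ?ltW// -mulr_natr -[c *+ 2]mulr_natr; field.
  by rewrite !gt_eqF.
(* N was chosen so that k / (pi N) <= e0 ^ 2; here c stands for pi. *)
rewrite sqrtr_ge0/= -(ger0_norm (ltW e00)) -sqrtr_sqr ler_wsqrtr//.
rewrite ler_pdivrMr ?mulr_gt0// mulrCA mulrA [X in _ <= X * _]mulrC -ler_pdivrMl; last first.
  by rewrite mulr_gt0 ?exprn_gt0.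
apply: ltW.
rewrite [ltLHS]mulrC [e0 ^+ 2 * c]mulrC; exact: truncnS_gt.
Qed.

(** * Velocities along a path of contactomorphisms *)

Section Velocity.
Context (R : realType).

(** At every point of [0, 1] at least one of the two one-sided neighbourhoods stays
    in the interval. *)
Lemma I01_within_proper (t : R) : I01 t ->
  ProperFilter (within [set h | I01 (t + h)] (0^')).
Proof.
move=> It; apply: Build_ProperFilter => -[e /= e0 eP].
move: It; rewrite /I01/= in_itv/= => /andP[t0 t1].
(* At most 1/2, so that t + d or t - d stays in [0, 1]. *)
pose d := Num.min (e / 2) (2^-1 : R).
have d0 : 0 < d by rewrite lt_min !divr_gt0//= invr_gt0.
have de : d < e by rewrite gt_min ltr_pdivrMr// ltr_pMr// ltr1n.
have d2 : d <= 2^-1 by rewrite ge_min lexx orbT.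
have [th|th] := leP t 2^-1.
  apply: (eP d) => /=; rewrite ?sub0r ?normrN ?gtr0_norm ?gt_eqF//.
  by rewrite /I01/= in_itv/=; apply/andP; split; lra.
apply: (eP (- d)) => /=; rewrite ?sub0r ?opprK ?gtr0_norm ?oppr_eq0 ?gt_eqF//.
by rewrite /I01/= in_itv/=; apply/andP; split; lra.
Qed.

Lemma one_sided_velocity (V : normedModType R) (c g : R -> V) (t : R) (v : V) : I01 t ->
  is_derive t (1 : R) g v -> (\forall s \near t, I01 s -> g s = c s) ->
  lim ((h^-1 *: (c (t + h) - c t)) @[h --> within [set h | I01 (t + h)] (0^')]) = v.
Proof.
move=> It [dg <-] gc.
have PF := I01_within_proper It.
apply: (cvg_lim (@norm_hausdorff _ _)).
have gt : g t = c t := nbhs_singleton gc It.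
have : (h^-1 *: ((g \o shift t) (h *: 1) - g t))
     @[h --> within [set h | I01 (t + h)] (0^')] --> 'D_1 g t.
  by apply: cvg_trans dg; apply: cvg_app; exact: cvg_within.
apply: cvg_trans; apply: near_eq_cvg.
have : \forall h \near (0 : R)^', I01 (t + h) -> g (t + h) = c (t + h).
  apply: cvg_within; move: gc; rewrite (near_shift 0) subr0.
  by apply: filterS => h /=; rewrite addrC.
apply: filterS => h /= gch Ith.
by rewrite /= [h *: 1]mulr1 [h + t]addrC gt gch.
Qed.

Lemma one_sided_lim_eq (V : normedModType R) (c1 c2 : R -> V) t : I01 t ->
  (forall s, I01 s -> c1 s = c2 s) ->
  lim ((h^-1 *: (c1 (t + h) - c1 t)) @[h --> within [set h | I01 (t + h)] (0^')]) =
  lim ((h^-1 *: (c2 (t + h) - c2 t)) @[h --> within [set h | I01 (t + h)] (0^')]).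
Proof.
move=> It c12; congr (lim _).
have E h : I01 (t + h) -> h^-1 *: (c1 (t + h) - c1 t) = h^-1 *: (c2 (t + h) - c2 t).
  by move=> Ih; rewrite !c12.
by rewrite eqEsubset; split; apply: near_eq_cvg; rewrite /prop_near1 /nbhs/= /within/=;
  apply: filterE => h Ih; rewrite E.
Qed.

End Velocity.

Lemma continuous_near_gt (R : realType) (V : topologicalType) (h : V -> R) (x : V) (a : R) :
  {for x, continuous h} -> a < h x -> \forall y \near x, a < h y.
Proof. by move=> hc ah; exact: (hc _ (lt_nbhsr ah)). Qed.

Lemma open_setI_preimage (R : realType) (V W : normedModType R) (A : set V) (B : set W) (h : V -> W) :
  open A -> open B -> (forall x, A x -> {for x, continuous h}) -> open (A `&` h @^-1` B).
Proof.
move=> oA oB hc; rewrite openE => x [Ax Bx]; apply: filterI.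
  exact: open_nbhs_nbhs.
by apply: hc => //; exact: open_nbhs_nbhs.
Qed.

Section ContactForm.
Context (R : realType) (n : nat).

Lemma contact_form_linear (x : J1 R n) : linear (contact_form x).
Proof.
move=> a u v; rewrite /contact_form/=.
rewrite [X in _ = X + _]mulrBr mulr_sumr addrACA -opprD -big_split/=.
congr (_ - _); apply: eq_bigr => i _.
by rewrite !mxE; ring.
Qed.

Lemma contact_form_continuous (V : topologicalType) (x v : V -> J1 R n) (a : V) :
  {for a, continuous x} -> {for a, continuous v} ->
  {for a, continuous (fun y => contact_form (x y) (v y))}.
Proof.
move=> cx cv.
have cq (g : V -> J1 R n) i : {for a, continuous g} -> {for a, continuous (fun y => (g y).1.1 0 i)}.
  move=> cg; apply: (@continuous_comp _ _ _ g (fun w : J1 R n => w.1.1 0 i)) => //.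
  apply: (@continuous_comp _ _ _ (fun w : J1 R n => w.1.1) (fun v : 'rV[R]_n => v 0 i)).
    apply: (@continuous_comp _ _ _ (fun w : J1 R n => w.1) fst); exact: cvg_fst.
  exact: coord_continuous.
have cp (g : V -> J1 R n) i : {for a, continuous g} -> {for a, continuous (fun y => (g y).1.2 0 i)}.
  move=> cg; apply: (@continuous_comp _ _ _ g (fun w : J1 R n => w.1.2 0 i)) => //.
  apply: (@continuous_comp _ _ _ (fun w : J1 R n => w.1.2) (fun v : 'rV[R]_n => v 0 i)).
    by apply: (@continuous_comp _ _ _ (fun w : J1 R n => w.1) snd); [exact: cvg_fst|exact: cvg_snd].
  exact: coord_continuous.
have cz (g : V -> J1 R n) : {for a, continuous g} -> {for a, continuous (fun y => (g y).2)}.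
  move=> cg; apply: (@continuous_comp _ _ _ g snd) => //; exact: cvg_snd.
apply: (@continuousB _ _ _ (fun y => (v y).2) (fun y => \sum_(i < n) (x y).1.2 0 i * (v y).1.1 0 i)).
  exact: cz.
pose Ff i y := (x y).1.2 0 i * (v y).1.1 0 i.
apply: (@cvg_big R 'I_n +%R 0 xpredT (@add_continuous _) V (nbhs a) (index_enum _) Ff (Ff ^~ a)).
move=> i _; apply: (@continuousM _ _ (fun y => (x y).1.2 0 i) (fun y => (v y).1.1 0 i)).
  exact: cp.
exact: cq.
Qed.

Lemma contact_form_reeb (y : J1 R n) : contact_form y (reeb R n) = 1.
Proof.
by rewrite /contact_form /= big1 ?subr0// => i _; rewrite !mxE mulr0.
Qed.

End ContactForm.

(** The contact Hamiltonian of the path f, as a function of the source point y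
    and not of f t y. The limit is the derivative of t |-> f t y within [0, 1]. *)
Definition hamiltonian (R : realType) (n : nat) (f : R -> J1 R n -> J1 R n)
    (t : R) (y : J1 R n) : R :=
  contact_form (f t y) (lim ((h^-1 *: (f (t + h) y - f t y))
         @[h --> within [set h | I01 (t + h)] (0^')])).

(** The function mu for which the pull-back of the contact form by f t is mu
    times the contact form. *)
Definition conformal (R : realType) (n : nat) (f : R -> J1 R n -> J1 R n)
    (t : R) (y : J1 R n) : R :=
  contact_form (f t y) ('d (f t) y (reeb R n)).

Section ContactPath.
Context (R : realType) (n : nat) (f : R -> J1 R n -> J1 R n).
Hypothesis f_path : contactomorphism_path f.
Hypothesis f_id : forall x, f 0 x = x.

Let J := (J1 R n : normedModType R).
Let RJ := (R * J : normedModType R)%type.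

Lemma path_extension (t : R) (y : J) : I01 t -> exists (U : set RJ) (g : RJ -> J),
  [/\ open U, U (t, y), smooth_open U g & forall s x, U (s, x) -> I01 s -> g (s, x) = f s x].
Proof.
move=> It; have [|U [g [oU Uty sg gf]]] := f_path.1 (t, y); first by split.
by exists U, g; split=> // s x Usx Is; rewrite gf.
Qed.

Section Extension.
Variables (U : set RJ) (g : RJ -> J).
Hypothesis oU : open U.
Hypothesis sg : smooth_open U g.
Hypothesis gf : forall s x, U (s, x) -> I01 s -> g (s, x) = f s x.

(** Within [0, 1] the path s |-> f s (c s) is read through the extension, to which
    the chain rule applies. *)
Lemma extension_curve (t : R) (c : R -> J) (w : J) : I01 t -> U (t, c t) ->
  is_derive t (1 : R) c w ->
  lim ((h^-1 *: (f (t + h) (c (t + h)) - f t (c t)))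
         @[h --> within [set h | I01 (t + h)] (0^')]) = 'd g (t, c t) (1, w).
Proof.
move=> It Ut dc.
have cd : differentiable c t by apply/derivable1_diffP; exact: ex_derive.
have dpr : is_diff t (fun s => (s, c s)) (fun h => (h, 'd c t h)).
  have cd' : is_diff t c ('d c t) by exact: DiffDef.
  exact: (is_diff_pair (is_diff_id t) cd').
have dg : differentiable g ((fun s => (s, c s)) t) by exact: smooth_open_diff sg _.
have dpr' := @ex_diff _ _ _ _ _ _ _ dpr.
apply: (@one_sided_velocity _ _ (fun s => f s (c s)) (g \o (fun s => (s, c s))) t _ It).
- apply: DeriveDef; first by apply: diff_derivable; exact: differentiable_comp.
  rewrite deriveE; last exact: differentiable_comp.
  rewrite diff_comp//=; congr ('d g _ _).
  by rewrite (@diff_val _ _ _ _ _ _ _ dpr) -deriveE// derive_val.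
- have : \forall s \near t, U (s, c s).
    have : {for t, continuous (fun s => (s, c s))} by exact: differentiable_continuous.
    by apply; exact: open_nbhs_nbhs.
  by apply: filterS => s Us Is /=; rewrite gf.
Qed.

(** The slice f t coincides near y with the slice of the extension, as t lies
    in [0, 1]. *)
Lemma extension_diff (t : R) (y w : J) : I01 t -> U (t, y) ->
  'd (f t) y w = 'd g (t, y) (0, w).
Proof.
move=> It Ut.
have dpr : is_diff y (fun x => (t, x)) (fun h => (0, h)).
  exact: (is_diff_pair (is_diff_cst t y) (is_diff_id y)).
have dpr' := @ex_diff _ _ _ _ _ _ _ dpr.
have dg : differentiable g ((fun x => (t, x)) y) by exact: smooth_open_diff sg _.
have dgc : differentiable (g \o (fun x => (t, x))) y by exact: differentiable_comp.
have [_ fE] : is_diff y (f t) ('d (g \o (fun x => (t, x))) y).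
  apply: near_eq_is_diff => //.
  have : \forall x \near y, U (t, x).
    have : {for y, continuous (fun x => (t, x))} by exact: differentiable_continuous.
    by apply; exact: open_nbhs_nbhs.
  by apply: filterS => x Ux /=; rewrite gf.
apply: etrans (congr1 (fun h => h w) fE) _.
apply: etrans (congr1 (fun h => h w) (diff_comp dpr' dg)) _.
exact: (congr1 (fun h => 'd g (t, y) (h w)) (@diff_val _ _ _ _ _ _ _ dpr)).
Qed.

End Extension.

(** Only times in [0, 1] are meaningful, whence the two auxiliary functions: they
    are built from the partial derivatives of a smooth extension of the path to a
    neighbourhood of the point. *)
Lemma hamiltonian_conformal_continuous (t0 : R) (y0 : J) : I01 t0 ->
  exists H mu : RJ -> R,
  [/\ {for (t0, y0), continuous H}, {for (t0, y0), continuous mu} &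
   \forall u \near (t0, y0), I01 u.1 ->
     hamiltonian f u.1 u.2 = H u /\ conformal f u.1 u.2 = mu u].
Proof.
move=> It0; have [U [g [oU Ut0 sg gf]]] := path_extension y0 It0.
exists (fun u => contact_form (g u) ('D_(1, 0) g u)),
  (fun u => contact_form (g u) ('D_(0, reeb R n) g u)).
have gc : {for (t0, y0), continuous g}.
  by apply: differentiable_continuous; exact: smooth_open_diff sg Ut0.
have Dgc v : {for (t0, y0), continuous ('D_v g)}.
  by apply: differentiable_continuous; exact: smooth_open_diff (smooth_derive v sg) Ut0.
split; [exact: (contact_form_continuous gc (Dgc _))|exact: (contact_form_continuous gc (Dgc _))|].
apply: filterS (open_nbhs_nbhs (conj oU Ut0)) => -[t y] /= Uty It.
have dg : differentiable g (t, y) by exact: smooth_open_diff sg Uty.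
have gE := gf t y Uty It.
split; last first.
  rewrite /conformal -gE deriveE//; congr (contact_form _ _).
  exact: (extension_diff oU sg gf _ It Uty).
rewrite /hamiltonian -gE deriveE//; congr (contact_form _ _).
rewrite gE.
exact: (extension_curve oU sg gf (c := fun=> y) It Uty (is_derive_cst y t (1 : R))).
Qed.

(** Subtracting from w its Reeb component leaves a vector of the contact plane,
    which f t keeps in the contact plane. *)
Lemma conformal_mul t (y w : J1 R n) : I01 t ->
  contact_form (f t y) ('d (f t) y w) = conformal f t y * contact_form y w.
Proof.
move=> It; have [_ fxi] := f_path.2 t It.
set a := contact_form y w.
have [L LE] := linear_pack (contact_form_linear (f t y)).
have [Ly LyE] := linear_pack (contact_form_linear y).
have w0 : contact_plane y (w - a *: reeb R n).
  rewrite /contact_plane/= LyE linearB linearZ/= -LyE contact_form_reeb.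
  by rewrite [_ *: _]mulr1 subrr.
have : contact_plane (f t y) ('d (f t) y (w - a *: reeb R n)).
  by rewrite -fxi; exists (w - a *: reeb R n).
rewrite /contact_plane/= linearB linearZ LE linearB linearZ -LE.
by move=> /eqP; rewrite subr_eq0 => /eqP ->; rewrite mulrC.
Qed.

(** Otherwise the Reeb vector would be sent into the contact plane, which is the
    image of the contact plane; by injectivity of the differential the Reeb vector
    would be tangent to the contact plane. *)
Lemma conformal_neq0 t (y : J) : I01 t -> conformal f t y != 0.
Proof.
move=> It; have [df fxi] := f_path.2 t It; apply/eqP => m0.
have : contact_plane (f t y) ('d (f t) y (reeb R n)) by [].
rewrite -fxi => -[u yu /(diffeomorphism_diffK df) uE].
move: yu; rewrite uE /contact_plane/= contact_form_reeb => /eqP.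
by rewrite oner_eq0.
Qed.

Lemma conformal0 (y : J) : conformal f 0 y = 1.
Proof.
rewrite /conformal.
have fE : f 0 = id by apply/funext.
have -> : 'd (f 0) y (reeb R n) = reeb R n.
  rewrite fE; exact: (congr1 (fun h => h (reeb R n)) (@diff_val _ _ _ _ _ _ _ (is_diff_id y))).
exact: contact_form_reeb.
Qed.

(** The conformal factor is 1 at time 0, never vanishes and is continuous in time:
    a path of contactomorphisms from the identity preserves the coorientation. *)
Lemma conformal_gt0 t (y : J) : I01 t -> 0 < conformal f t y.
Proof.
move=> It; rewrite ltNge; apply/negP => mt.
have t0 : 0 <= t by move: It; rewrite /I01/= in_itv/= => /andP[].
have sub : `[0, t]%classic `<=` (@I01 R).
  move=> s; move: It; rewrite /I01/= !in_itv/= => /andP[_ t1] /andP[-> st] /=.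
  exact: le_trans st t1.
have [||s st ms] := @IVT R (fun s => conformal f s y) 0 t 0 t0.
- apply/subspace_continuousP => s st.
  have [H [mu [_ muc Emu]]] := hamiltonian_conformal_continuous y (sub _ st).
  have pc : {for s, continuous (fun r : R => (r, y))}.
    have pd : differentiable (fun r : R => (r, y)) s by apply: differentiable_pair.
    exact: differentiable_continuous pd.
  have mc : {for s, continuous (fun r => mu (r, y))}.
    exact: (continuous_comp pc muc).
  have Es : conformal f s y = mu (s, y) by have [_] := nbhs_singleton Emu (sub _ st).
  suff : conformal f r y @[r --> within `[0, t] (nbhs s)] --> conformal f s y by [].
  have mw : mu (r, y) @[r --> within `[0, t] (nbhs s)] --> mu (s, y) by exact: cvg_within_filter.
  rewrite Es; apply: cvg_trans mw.
  apply: near_eq_cvg.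
  have : \forall r \near s, I01 r -> hamiltonian f r y = H (r, y) /\ conformal f r y = mu (r, y).
    exact: (pc _ Emu).
  by apply: filterS => r /= Er rt; have [_ ->] := Er (sub _ rt).
- by rewrite conformal0 ge_min le_max ler01 mt orbT.
- by have := conformal_neq0 y (sub _ st); rewrite ms eqxx.
Qed.

(** Velocity of y = c t carried along by the flow: the flow contributes its
    Hamiltonian and the curve contributes through the conformal factor. *)
Lemma contact_form_velocity (t : R) (c : R -> J) (w : J) : I01 t ->
  is_derive t (1 : R) c w ->
  contact_form (f t (c t)) (lim ((h^-1 *: (f (t + h) (c (t + h)) - f t (c t)))
         @[h --> within [set h | I01 (t + h)] (0^')])) =
  hamiltonian f t (c t) + conformal f t (c t) * contact_form (c t) w.
Proof.
move=> It dc; have [U [g [oU Ut sg gf]]] := path_extension (c t) It.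
rewrite (extension_curve oU sg gf It Ut dc) -conformal_mul//.
rewrite (extension_diff oU sg gf w It Ut) /hamiltonian.
rewrite (extension_curve oU sg gf (c := fun=> c t) It Ut (is_derive_cst (c t) t (1 : R))).
have [L LE] := linear_pack (contact_form_linear (f t (c t))).
rewrite LE -linearD -linearD.
by congr (L ('d g _ _)); rewrite -[RHS]/(1 + 0, 0 + w) addr0 add0r.
Qed.

Lemma smooth_family_flow m (L : smooth_manifold R m) (i : L -> J1 R n) (Phi : R -> J -> J) :
  smooth_map i -> smooth_open setT (fun u : RJ => Phi u.1 u.2) ->
  smooth_family (fun p t => f t (Phi t (i p))).
Proof.
move=> si sPhi c ac [y0 t0] [/= cy0 It0].
have [U1 [g1 [oU1 U1y sg1 g1f]]] := si c ac y0 cy0.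
have [U2 [g2 [oU2 U2y sg2 g2f]]] := path_extension (Phi t0 (g1 y0)) It0.
pose A : set ('rV[R]_m * R) := fst @^-1` U1.
have oA : open A by apply: open_comp => // x _; exact: cvg_fst.
have sfst : smooth_open A (@fst 'rV[R]_m R) by apply: smooth_linear => // x; exact: cvg_fst.
have ssnd : smooth_open A (@snd 'rV[R]_m R) by apply: smooth_linear => // x; exact: cvg_snd.
have sg : smooth_open A (fun u => g1 u.1).
  exact: (smooth_comp (U' := U1) (frame_rV R m) oA _ sfst sg1).
have sp : smooth_open A (fun u => (u.2, g1 u.1)) by exact: smooth_pair.
have fRJ : finite_frame RJ by apply: frame_prod; [exact: frame_R|exact: J1_frame].
pose h (u : 'rV[R]_m * R) : RJ := (u.2, Phi u.2 (g1 u.1)).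
have sh : smooth_open A h.
  apply: smooth_pair => //.
  exact: (smooth_comp (U' := setT) fRJ oA _ sp sPhi).
have oW : open (A `&` h @^-1` U2).
  apply: open_setI_preimage => // u Au; apply: differentiable_continuous.
  exact: smooth_open_diff sh Au.
exists (A `&` h @^-1` U2), (g2 \o h); split=> //.
- apply: (smooth_comp (U' := U2) fRJ oW) => //; first by move=> u [].
  by apply: smooth_open_sub sh => u [].
- move=> [y t] [/= Ay U2u] [/= cy It].
  by rewrite /h g2f//= g1f.
Qed.

(** * Positivity that survives small displacements *)

Section Margin.
Variable rho : J -> R.
Hypothesis rho_continuous : continuous rho.
Hypothesis rho_ge0 : forall x, 0 <= rho x.

(** If H > 0 at (t0, x0), positivity persists nearby since the other term is
    nonnegative. Otherwise rho is positive at x0, and a large k makes the second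
    term dominate the lower bound of H. *)
Lemma local_margin (t0 : R) (x0 : J) : I01 t0 ->
  0 < hamiltonian f t0 x0 \/ 0 < rho x0 ->
  exists k0 e : R, [/\ 0 <= k0, 0 < e & forall t y x k, I01 t -> ball t0 e t -> ball x0 e y ->
    ball x0 e x -> k0 < k -> 0 < hamiltonian f t y + conformal f t y * (k * rho x ^+ 2)].
Proof.
move=> It0 pos.
have [H [mu [Hc muc E]]] := hamiltonian_conformal_continuous x0 It0.
have [H0 mu0] := nbhs_singleton E It0.
case: pos => [pos|rho0].
  have near_H : \forall u \near (t0, x0), 0 < H u.
    by apply: continuous_near_gt => //; rewrite -H0.
  have [e e0 eP] : exists2 e : R, 0 < e & ball (t0, x0) e `<=`
      [set u | 0 < H u /\ (I01 u.1 -> hamiltonian f u.1 u.2 = H u /\ conformal f u.1 u.2 = mu u)].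
    by apply/nbhs_ballP; exact: filterI.
  exists 0, e; split=> // t y x k It bt by_ bx k0.
  have [/= Hpos /(_ It)[-> _]] := eP (t, y) (conj bt by_).
  rewrite ltr_pwDl// mulr_ge0 ?mulr_ge0 ?exprn_ge0// ltW//.
  exact: conformal_gt0.
have mupos : 0 < mu (t0, x0) by rewrite -mu0; exact: conformal_gt0.
have near_H : \forall u \near (t0, x0), H (t0, x0) - 1 < H u.
  by apply: continuous_near_gt => //; rewrite ltrBlDr ltrDl.
have near_mu : \forall u \near (t0, x0), mu (t0, x0) / 2 < mu u.
  by apply: continuous_near_gt => //; lra.
have near_rho : \forall x \near x0, rho x0 / 2 < rho x.
  by apply: continuous_near_gt; [exact: rho_continuous|lra].
have [e1 e10 e1P] : exists2 e : R, 0 < e & ball (t0, x0) e `<=`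
      [set u | H (t0, x0) - 1 < H u /\ (mu (t0, x0) / 2 < mu u /\
       (I01 u.1 -> hamiltonian f u.1 u.2 = H u /\ conformal f u.1 u.2 = mu u))].
  by apply/nbhs_ballP; apply: filterI => //; exact: filterI.
have [e2 e20 e2P] : exists2 e : R, 0 < e & ball x0 e `<=` [set x | rho x0 / 2 < rho x].
  exact/nbhs_ballP.
(* Lower bound near (t0, x0) for the factor of k. *)
pose c := mu (t0, x0) / 2 * (rho x0 / 2) ^+ 2.
have c0 : 0 < c by rewrite mulr_gt0 ?exprn_gt0 ?divr_gt0.
exists ((1 + `|H (t0, x0)|) / c), (Num.min e1 e2); split.
- by rewrite divr_ge0 ?addr_ge0// ltW.
- by rewrite lt_min e10 e20.
move=> t y x k It bt by_ bx; rewrite ltr_pdivrMr// => ck.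
have le1 : Num.min e1 e2 <= e1 by rewrite ge_min lexx.
have le2 : Num.min e1 e2 <= e2 by rewrite ge_min lexx orbT.
have [/= Hlb [mulb /(_ It)[-> ->]]] := e1P (t, y) (conj (le_ball le1 bt) (le_ball le1 by_)).
have /= rholb := e2P x (le_ball le2 bx).
have k0 : 0 < k.
  by rewrite -(pmulr_lgt0 _ c0) (le_lt_trans _ ck)// addr_ge0.
have : k * c <= mu (t, y) * (k * rho x ^+ 2).
  rewrite /c mulrCA ler_pM ?(ltW k0) ?mulr_ge0 ?exprn_ge0 ?(ltW k0)// ?divr_ge0 ?(ltW mupos) ?(ltW rho0)//.
    exact: ltW.
  rewrite ler_wpM2l ?(ltW k0)// ler_sqr ?nnegrE ?divr_ge0 ?(ltW rho0)//.
  exact: ltW.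
have := ler_norm (- H (t0, x0)); rewrite normrN; lra.
Qed.

(** The pairs (k, d) range over a filter, k large and d small, and compactness of
    [0, 1] times K turns the local statement into a uniform one. *)
Lemma uniform_margin (K : set J) : compact K ->
  (forall t x, I01 t -> K x -> 0 < hamiltonian f t x \/ 0 < rho x) ->
  exists k d : R, [/\ 0 < k, 0 < d & forall t x y, I01 t -> K x -> `|x - y| <= d ->
    0 < hamiltonian f t y + conformal f t y * (k * rho x ^+ 2)].
Proof.
move=> Kc pos.
have KKc : compact ((@I01 R) `*` K) by apply: compact_setX => //; exact: segment_compact.
pose P (i : R * R) (u : RJ) := forall y, `|u.2 - y| <= i.2 ->
    0 < hamiltonian f u.1 y + conformal f u.1 y * (i.1 * rho u.2 ^+ 2).
have /near_covering_withinP/(_ _ (filter_prod (+oo%R : set_system R) (0 : R)^'+) P _) :=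
  (compact_near_coveringP _).1 KKc.
case.
  move=> [t0 x0] [/= It0 Kx0].
  have [k0 [e [k00 e0 eP]]] := local_margin It0 (pos t0 x0 It0 Kx0).
  have e20 : 0 < e / 2 by rewrite divr_gt0.
  exists (ball (t0, x0) (e / 2), [set i : R * R | k0 < i.1 /\ i.2 < e / 2]) => /=.
    split; first exact: nbhsx_ballx.
    exists ([set k | k0 < k], [set d | d < e / 2]) => //=.
    split; first by apply: nbhs_pinfty_gt; exact: num_real.
    exact: nbhs_right_lt.
  move=> [[t x] [k d]] /= [[/= bt bx] [kk dd]] [/= It Kx] y xy.
  apply: eP => //.
  - by apply: le_ball bt; lra.
  - rewrite (splitr e); apply: ball_triangle bx _.
    by rewrite -ball_normE/= (le_lt_trans xy).
  - by apply: le_ball bx; lra.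
move=> [A B] /= [nA nB] AB.
have [k [Ak k0]] : exists k, A k /\ 0 < k.
  by apply: filter_ex (filterI nA (nbhs_pinfty_gt (num_real 0))).
have [d [Bd d0]] : exists d, B d /\ 0 < d.
  by apply: filter_ex (filterI nB (nbhs_right_gt 0)).
exists k, d; split=> // t x y It Kx xy.
exact: (AB (k, d) (conj Ak Bd) (t, x)).
Qed.

End Margin.

End ContactPath.

(** * The positive isotopy *)

Theorem corollary1p9 (R : realType) (n : nat) (n_ge1 : (1 <= n)%N)
    (L : smooth_manifold R n) (iota : L -> R -> J1 R n)
    (iota_legendrian : legendrian_isotopy iota)
    (iota_induced : induced_by_contactomorphisms iota)
    (iota_positive : exists C : set L, compact C /\ positive_outside C iota) :
  exists iota' : L -> R -> J1 R n,
    [/\ positive_isotopy iota',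
        isotopy_between iota' (slice iota 0) (slice iota 1) &
        exists C' : set L, compact C' /\
          forall (p : L) (t : R), ~ C' p -> I01 t -> iota' p t = iota p t].
Proof.
have [[_ iota_emb] _] := iota_legendrian.
have [f [f_path f_id f_iota]] := iota_induced.
have [C [Cc Cpos]] := iota_positive.
have I0 : I01 (0 : R) by rewrite /I01/= in_itv/= lexx ler01.
have I1 : I01 (1 : R) by rewrite /I01/= in_itv/= lexx ler01.
pose i p := iota p 0.
have emb_i : proper_embedding i by exact: iota_emb.
have [smooth_i _ top_i proper_i] := emb_i.
have i_continuous : continuous i.
  apply/continuousP => V oV; apply/top_i.2; by exists V.
have [r0 Cr0] : exists r0, forall p, C p -> `|i p| <= r0.
  have iCc : compact (i @` C) by apply: continuous_compact => //; exact: continuous_subspaceT.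
  have [s [_ sP]] := compact_bounded iCc.
  exists (`|s| + 1) => p Cp; apply: sP; last by exists p.
  by rewrite ltr_pwDr// ler_norm.
have [rho [r [srho rho_ge0 rho_pos rho0]]] := smooth_bump r0 (J1_frame R n).
have rho_cont : continuous rho.
  by move=> x; apply: differentiable_continuous; exact: smooth_open_diff srho I.
pose K := range i `&` [set x | `|x| <= r].
have Kc : compact K by apply: proper_i; exact: J1_closed_ball_compact.
have ham_pos t p : I01 t -> ~ C p -> 0 < hamiltonian f t (i p).
  move=> It nCp.
  have lim_iota := one_sided_lim_eq It (f_iota p).
  have -> : hamiltonian f t (i p) = contact_form (iota p t) (velocity iota p t).
    exact: (congr2 (@contact_form R n) (esym (f_iota p t It)) (esym lim_iota)).
  exact: Cpos.
have [k [d [k0 d0 margin]]] : exists k d : R, [/\ 0 < k, 0 < d &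
    forall t x y, I01 t -> K x -> `|x - y| <= d ->
    0 < hamiltonian f t y + conformal f t y * (k * rho x ^+ 2)].
  apply: uniform_margin => // t x It [[p _ <-] _].
  have [Cp|nCp] := pselect (C p); [right|left; exact: ham_pos].
  exact/rho_pos/Cr0.
pose i0 := Ordinal n_ge1.
have [e0 [e00 e0P]] := loop_shift_closed_embedding i0 srho rho0 d0.
have [e [N [ee0 eN]]] := loop_parameters k0 e00.
pose w : R := pi *+ 2 *+ N.
have [small emb] := e0P e w ee0.
(* N full turns: the angular speed w makes the loop close up at time 1. *)
pose Phi (t : R) (x : J1 R n) : J1 R n := x + loop_shift i0 rho e w t x.
pose iota' p t := f t (Phi t (i p)).
have iota'0 p : iota' p 0 = iota p 0 by rewrite /iota' f_id /Phi loop_shift0 addr0.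
have iota'1 p : iota' p 1 = iota p 1.
  by rewrite /iota' /Phi loop_shift1 addr0 -f_iota.
have iso' : isotopy iota'.
  split.
    by apply: smooth_family_flow => //; exact: smooth_loop_shift.
  move=> t It; apply: (proper_embedding_comp (F := f t \o Phi t) emb_i).
  apply: closed_embedding_comp; first exact: emb.
  by apply: diffeomorphism_closed_embedding; case: (f_path.2 t It).
exists iota'; split.
- split=> // p t It.
  rewrite /positive_at /velocity.
  have dPhi : is_derive t (1 : R) (fun s => Phi s (i p)) (loop_velocity i0 rho e w t (i p)).
    exact: is_derive_loop_shift.
  rewrite (contact_form_velocity f_path It dPhi) contact_form_loop_shift -/w eN.
  have [ipr|rip] := leP `|i p| r.
    apply: margin => //.
    have -> : i p - Phi t (i p) = - loop_shift i0 rho e w t (i p).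
      by rewrite /Phi opprD addrA addrN add0r.
    rewrite normrN; exact: small.
  (* Off the ball the loop is constant, and the ball contains the image of C. *)
  rewrite (rho0 _ rip) expr0n/= !mulr0 addr0 /Phi loop_shift_rho0 ?rho0// addr0.
  apply: ham_pos => // Cp.
  by have := rho_pos _ (Cr0 _ Cp); rewrite rho0// ltxx.
- have slice_eq s : (forall p, iota' p s = iota p s) -> slice iota' s = slice iota s.
    by move=> E; congr image; apply/funext.
  by split=> //; exact: slice_eq.
- exists (i @^-1` [set x | `|x| <= r]); split.
    by apply: topological_embedding_compact_preimage.
  move=> p t /negP; rewrite -ltNge => rip It.
  by rewrite /iota' /Phi loop_shift_rho0 ?rho0// addr0 -f_iota.
Qed.
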